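(* Let $0<a<1$. Suppose that $g\in H^2(\mathbb{D})$ is analytic at $1$. Then $K_g$ is a minimal invariant subspace of $C_{\phi_a}$ if and only if $\dim K_g=1$.
   Context: $H^2=H^2(\mathbb{D})$ is the Hardy-Hilbert space of holomorphic functions on the open unit disk $\mathbb{D}$. For $a\in(0,1)$, $\phi_a(z)=az+1-a$, a holomorphic self-map of $\mathbb{D}$, and $C_{\phi_a}f=f\circ\phi_a$ is the (bounded) composition operator on $H^2$. For $f\in H^2$, $K_f:=\overline{\mathrm{span}\{f,C_{\phi_a}f,C_{\phi_a}^2f,\ldots\}}$ (closure in $H^2$). A minimal invariant subspace of $C_{\phi_a}$ is a nonzero closed invariant subspace whose only closed $C_{\phi_a}$-invariant subspaces are $\{0\}$ and itself. ''Analytic at $1$'' means that $g$ extends holomorphically to some open neighborhood of the point $1$ in $\mathbb{C}$. *)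

(* Defs.v *)
From Stdlib Require Import Reals Lra.
From Coquelicot Require Import Coquelicot.
Open Scope R_scope.

(* Functions on the disk have the subtype as domain, so that Leibniz equality
   of such functions (given functional extensionality and proof irrelevance)
   is equality on the disk, with no junk values outside it. *)
Definition disk : Type := {z : C | Cmod z < 1}.

Definition disk_val (z : disk) : C := proj1_sig z.
Coercion disk_val : disk >-> C.

Definition dfun : Type := disk -> C.

Definition dzero : dfun := fun _ => RtoC 0.
Definition dadd (f h : dfun) : dfun := fun z => (f z + h z)%C.
Definition dsub (f h : dfun) : dfun := fun z => (f z - h z)%C.
Definition dscal (c : C) (f : dfun) : dfun := fun z => (c * f z)%C.

Definition complex_differentiable_at (F : C -> C) (z : C) : Prop :=
  ex_derive (K := C_AbsRing) (V := C_NormedModule) F z.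

(* The extension [F] only serves to speak of derivatives of total functions:
   the disk being open, its values off the disk are irrelevant. *)
Definition holomorphic (f : dfun) : Prop :=
  exists F : C -> C,
    (forall z : disk, F z = f z) /\
    (forall z : disk, complex_differentiable_at F z).

Definition analytic_at_1 (g : dfun) : Prop :=
  exists (U : C -> Prop) (F : C -> C),
    open (T := C_UniformSpace) U /\ U (RtoC 1) /\
    (forall z : disk, U z -> F z = g z) /\
    (forall z : C, U z -> complex_differentiable_at F z).

Definition is_taylor (f : dfun) (c : nat -> C) : Prop :=
  forall z : disk,
    is_pseries (K := C_AbsRing) (V := C_NormedModule) c (z : C) (f z).

(* The Hardy norm as a relation: [r] is the l^2 norm of the Taylor
   coefficients of [f] at 0, which are determined by [f]. *)
Definition is_H2norm (f : dfun) (r : R) : Prop :=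
  0 <= r /\
  exists c : nat -> C,
    is_taylor f c /\ is_series (fun n => Cmod (c n) ^ 2) (r ^ 2).

Definition H2 (f : dfun) : Prop :=
  holomorphic f /\ exists r, is_H2norm f r.

Definition H2_closure (S : dfun -> Prop) (f : dfun) : Prop :=
  H2 f /\
  forall eps, 0 < eps ->
    exists h, S h /\ exists r, is_H2norm (dsub f h) r /\ r < eps.

Definition closed_subspace (M : dfun -> Prop) : Prop :=
  (forall f, M f -> H2 f) /\
  M dzero /\
  (forall f h, M f -> M h -> M (dadd f h)) /\
  (forall (c : C) f, M f -> M (dscal c f)) /\
  (forall f, H2_closure M f -> M f).

Fixpoint lincomb (d : nat) (c : nat -> C) (e : nat -> dfun) : dfun :=
  match d with
  | O => dzero
  | S k => dadd (lincomb k c e) (dscal (c k) (e k))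
  end.

Definition has_dim (M : dfun -> Prop) (d : nat) : Prop :=
  exists e : nat -> dfun,
    (forall i, (i < d)%nat -> M (e i)) /\
    (forall c, lincomb d c e = dzero ->
       forall i, (i < d)%nat -> c i = RtoC 0) /\
    (forall f, M f -> exists c, f = lincomb d c e).

Lemma phi_subproof (a : R) (Ha : 0 < a < 1) (z : disk) :
  Cmod (RtoC a * disk_val z + RtoC (1 - a))%C < 1.
Proof.
destruct z as [z Hz]; simpl.
eapply Rle_lt_trans; [apply Cmod_triangle|].
rewrite Cmod_mult, !Cmod_R, !Rabs_pos_eq by lra.
assert (a * Cmod z < a * 1) by (apply Rmult_lt_compat_l; lra).
lra.
Qed.

Definition phi (a : R) (Ha : 0 < a < 1) (z : disk) : disk :=
  exist (fun w : C => Cmod w < 1)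
    (RtoC a * disk_val z + RtoC (1 - a))%C (phi_subproof a Ha z).

Definition comp_op (a : R) (Ha : 0 < a < 1) (f : dfun) : dfun :=
  fun z => f (phi a Ha z).

Definition orbit_span (a : R) (Ha : 0 < a < 1) (f h : dfun) : Prop :=
  exists (d : nat) (c : nat -> C),
    h = lincomb d c (fun n => Nat.iter n (comp_op a Ha) f).

Definition K (a : R) (Ha : 0 < a < 1) (f : dfun) : dfun -> Prop :=
  H2_closure (orbit_span a Ha f).

Definition closed_invariant (a : R) (Ha : 0 < a < 1) (M : dfun -> Prop)
  : Prop :=
  closed_subspace M /\ forall f, M f -> M (comp_op a Ha f).

Definition minimal_invariant (a : R) (Ha : 0 < a < 1) (M : dfun -> Prop)
  : Prop :=
  closed_invariant a Ha M /\
  (exists f, M f /\ f <> dzero) /\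
  forall N : dfun -> Prop,
    closed_invariant a Ha N ->
    (forall f, N f -> M f) ->
    (forall f, N f -> f = dzero) \/ (forall f, M f -> N f).

(* Main.v *)
Require Import Defs.
From Stdlib Require Import Reals Lra Lia ssreflect ClassicalEpsilon FunctionalExtensionality.
From Coquelicot Require Import Coquelicot.
Open Scope R_scope.

(** Write [u = 1 - z].  The map [phi a] multiplies [u] by [a], so the
    functions [u ^ m] are eigenfunctions of the composition operator.  If
    [g <> 0] is analytic at 1, then near 1 it has an expansion
    [g = b u ^ m + O(u ^ (m + 1))] with [b <> 0].  The [n]-th iterate of the
    operator evaluates [g] at [a ^ n u], so dividing it by [b a ^ (n m)] gives
    [u ^ m + O(a ^ n)] uniformly on a disk of radius 2 once [a ^ n] is small,
    hence convergence to [u ^ m] in the Hardy norm.  Thus [K a Ha g] contains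
    the line spanned by [u ^ m] ([exists_eigenfunction_in_K]).

    This line is itself closed and invariant ([closed_invariant_eigenline]).
    If [K a Ha g] is minimal, it equals the line and has dimension 1.  If it has
    dimension 1, it equals the line again, whence its invariance, and a line is
    minimal.  For [g = 0] the space is zero ([K_zero]) and both sides fail.

    Existence of the expansion, and the passage from uniform to Hardy bounds,
    rest on one fact: a function that is merely complex differentiable on a
    disk is the sum of a power series whose coefficients decay geometrically,
    controlled by a bound on a circle ([cauchy_power_series]).  It comes from
    Cauchy's formula ([cauchy_formula]), proved with Goursat's bisection
    argument in the parameter rectangle of the family of circles that shrinks
    a given circle to an interior point ([boundary_integral_zero]), and from a
    geometric expansion of the Cauchy kernel.  That [m] exists for [g <> 0]
    uses the identity theorem ([vanish_near_one]). *)

(** * Complex differentiability *)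

Definition cdiff (F : C -> C) (z : C) : Prop :=
  exists l : C, forall eps, 0 < eps -> exists d, 0 < d /\
    forall y, Cmod (y - z)%C < d ->
      Cmod (F y - F z - l * (y - z))%C <= eps * Cmod (y - z)%C.

Lemma complex_differentiable_at_iff (F : C -> C) (z : C) :
  complex_differentiable_at F z <-> cdiff F z.
Proof.
  split.
  - intros [l [_ Hl]]. exists l. intros eps Heps.
    destruct (Hl z (fun P H => H) (mkposreal eps Heps)) as [d Hd].
    exists d. split; [apply cond_pos|]. intros y Hy.
    specialize (Hd y Hy).
    rewrite (Cmult_comm l). exact Hd.
  - intros [l Hl]. exists l. split; [apply is_linear_scal_l|].
    intros x Hx eps.
    apply (is_filter_lim_locally_unique (K:=C_AbsRing) (V:=AbsRing_NormedModule C_AbsRing)) in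
      Hx. subst x.
    destruct (Hl eps (cond_pos eps)) as [d [Hd H]].
    exists (mkposreal d Hd). intros y Hy. specialize (H y Hy).
    rewrite (Cmult_comm l) in H. exact H.
Qed.

Lemma Cmod_le_abs_sum (z : C) : Cmod z <= Rabs (fst z) + Rabs (snd z).
Proof.
  assert (H1 := Rabs_pos (fst z)). assert (H2 := Rabs_pos (snd z)).
  unfold Cmod. rewrite <- (sqrt_pow2 (Rabs (fst z) + Rabs (snd z))) by lra.
  apply sqrt_le_1_alt. rewrite <- (pow2_abs (fst z)), <- (pow2_abs (snd z)). nra.
Qed.

Lemma fst_le_Cmod (z : C) : Rabs (fst z) <= Cmod z.
Proof. eapply Rle_trans; [apply Rmax_l|apply Rmax_Cmod]. Qed.

Lemma snd_le_Cmod (z : C) : Rabs (snd z) <= Cmod z.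
Proof. eapply Rle_trans; [apply Rmax_r|apply Rmax_Cmod]. Qed.

Lemma Cmod_minus_le (x y : C) : Cmod (x - y)%C <= Cmod x + Cmod y.
Proof. unfold Cminus. rewrite <- (Cmod_opp y). apply Cmod_triangle. Qed.

Lemma Cmod_minus_sym (x y : C) : Cmod (x - y)%C = Cmod (y - x)%C.
Proof. rewrite <- Cmod_opp. f_equal. ring. Qed.

Lemma Cmod_minus_ge (x y : C) : Cmod x - Cmod y <= Cmod (x - y)%C.
Proof.
  assert (H := Cmod_triangle (x - y) y).
  replace (x - y + y)%C with x in H by ring. lra.
Qed.

Lemma cdiff_continuous F z : cdiff F z -> forall eps, 0 < eps -> exists d, 0 < d /\
  forall y, Cmod (y - z)%C < d -> Cmod (F y - F z)%C < eps.
Proof.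
  intros [l Hl] eps Heps. destruct (Hl 1 Rlt_0_1) as [d [Hd H]].
  assert (Hp : 0 < 1 + Cmod l) by (generalize (Cmod_ge_0 l); lra).
  exists (Rmin d (eps / (1 + Cmod l))). split.
  - apply Rmin_glb_lt; auto. apply Rdiv_lt_0_compat; lra.
  - intros y Hy. assert (Hy1 := Rlt_le_trans _ _ _ Hy (Rmin_l _ _)).
    assert (Hy2 := Rlt_le_trans _ _ _ Hy (Rmin_r _ _)).
    specialize (H y Hy1).
    replace (F y - F z)%C with ((F y - F z - l * (y - z)) + l * (y - z))%C by ring.
    eapply Rle_lt_trans; [apply Cmod_triangle|]. rewrite Cmod_mult.
    apply Rle_lt_trans with ((1 + Cmod l) * Cmod (y - z)); [lra|].
    apply Rlt_le_trans with ((1 + Cmod l) * (eps / (1 + Cmod l))).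
    + apply Rmult_lt_compat_l; auto.
    + right. field. lra.
Qed.

Lemma cdiff_const c z : cdiff (fun _ => c) z.
Proof.
  exists (RtoC 0). intros eps He. exists 1. split; [lra|]. intros y _.
  replace (c - c - 0 * (y - z))%C with (RtoC 0) by ring. rewrite Cmod_0.
  apply Rmult_le_pos; [lra|apply Cmod_ge_0].
Qed.

Lemma cdiff_minus F G z : cdiff F z -> cdiff G z -> cdiff (fun x => F x - G x)%C z.
Proof.
  intros [l Hl] [k Hk]. exists (l - k)%C. intros eps He.
  destruct (Hl (eps/2)) as [d [Hd H]]; [lra|].
  destruct (Hk (eps/2)) as [d' [Hd' H']]; [lra|].
  exists (Rmin d d'). split; [now apply Rmin_glb_lt|]. intros y Hy.
  assert (Hy1 := Rlt_le_trans _ _ _ Hy (Rmin_l _ _)).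
  assert (Hy2 := Rlt_le_trans _ _ _ Hy (Rmin_r _ _)).
  specialize (H y Hy1). specialize (H' y Hy2).
  replace (F y - G y - (F z - G z) - (l - k) * (y - z))%C
    with ((F y - F z - l * (y - z)) - (G y - G z - k * (y - z)))%C by ring.
  eapply Rle_trans; [apply Cmod_minus_le|]. lra.
Qed.

Lemma cdiff_affine_comp F (p q : C) z : cdiff F (p + q * z)%C ->
  cdiff (fun x => F (p + q * x)%C) z.
Proof.
  intros [l Hl]. exists (l * q)%C. intros eps He.
  assert (Hq : 0 < 1 + Cmod q) by (generalize (Cmod_ge_0 q); lra).
  destruct (Hl (eps/(1 + Cmod q))) as [d [Hd H]]; [apply Rdiv_lt_0_compat; lra|].
  exists (d / (1 + Cmod q)). split; [apply Rdiv_lt_0_compat; lra|]. intros y Hy.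
  assert (E : (p + q * y - (p + q * z))%C = (q * (y - z))%C) by ring.
  assert (B : Cmod (q * (y - z))%C <= (1 + Cmod q) * Cmod (y - z)).
  { rewrite Cmod_mult. apply Rmult_le_compat_r; [apply Cmod_ge_0|lra]. }
  specialize (H (p + q * y)%C). rewrite E in H.
  replace (l * q * (y - z))%C with (l * (q * (y - z)))%C by ring.
  eapply Rle_trans; [apply H|].
  - eapply Rle_lt_trans; [apply B|].
    apply Rlt_le_trans with ((1 + Cmod q) * (d / (1 + Cmod q))).
    + apply Rmult_lt_compat_l; auto.
    + right; field; lra.
  - apply Rle_trans with (eps / (1 + Cmod q) * ((1 + Cmod q) * Cmod (y - z))).
    + apply Rmult_le_compat_l; auto. apply Rlt_le, Rdiv_lt_0_compat; lra.
    + right; field; lra.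
Qed.

Lemma cdiff_scal F c z : cdiff F z -> cdiff (fun x => c * F x)%C z.
Proof.
  intros [l Hl]. exists (c * l)%C. intros eps He.
  assert (Hq : 0 < 1 + Cmod c) by (generalize (Cmod_ge_0 c); lra).
  destruct (Hl (eps/(1 + Cmod c))) as [d [Hd H]]; [apply Rdiv_lt_0_compat; lra|].
  exists d. split; auto. intros y Hy. specialize (H y Hy).
  replace (c * F y - c * F z - c * l * (y - z))%C with (c * (F y - F z - l * (y - z)))%C
    by ring.
  rewrite Cmod_mult. apply Rle_trans with ((1 + Cmod c) * (eps / (1 + Cmod c) * Cmod (y - z))).
  - apply Rmult_le_compat; try apply Cmod_ge_0; auto. lra.
  - right; field; lra.
Qed.

Lemma cdiff_mult_id F z : cdiff F z -> cdiff (fun x => x * F x)%C z.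
Proof.
  intros HF. assert (Hc := cdiff_continuous _ _ HF). destruct HF as [l Hl].
  exists (F z + z * l)%C. intros eps He.
  assert (Hq : 0 < 1 + Cmod z) by (generalize (Cmod_ge_0 z); lra).
  destruct (Hl (eps/2/(1 + Cmod z))) as [d [Hd H]]; [apply Rdiv_lt_0_compat; lra|].
  destruct (Hc (eps/2)) as [d' [Hd' H']]; [lra|].
  exists (Rmin d d'). split; [now apply Rmin_glb_lt|]. intros y Hy.
  assert (Hy1 := Rlt_le_trans _ _ _ Hy (Rmin_l _ _)).
  assert (Hy2 := Rlt_le_trans _ _ _ Hy (Rmin_r _ _)).
  specialize (H y Hy1). specialize (H' y Hy2).
  replace (y * F y - z * F z - (F z + z * l) * (y - z))%C
    with (z * (F y - F z - l * (y - z)) + (F y - F z) * (y - z))%C by ring.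
  eapply Rle_trans; [apply Cmod_triangle|]. rewrite !Cmod_mult.
  apply Rle_trans with ((1 + Cmod z) * (eps / 2 / (1 + Cmod z) * Cmod (y - z)) + eps/2 * Cmod (y
    - z)).
  - apply Rplus_le_compat; apply Rmult_le_compat; try apply Cmod_ge_0; auto; lra.
  - right; field; lra.
Qed.

Lemma cdiff_pow m z : cdiff (fun x => x ^ m)%C z.
Proof.
  induction m; [exact (cdiff_const (RtoC 1) z)|].
  exact (cdiff_mult_id (fun x => x ^ m)%C z IHm).
Qed.

Lemma cdiff_ext_loc F G z d : 0 < d -> (forall y, Cmod (y - z) < d -> F y = G y) -> cdiff F z ->
  cdiff G z.
Proof.
  intros Hd E [l Hl]. exists l. intros eps He. destruct (Hl eps He) as [d' [Hd' H]].
  exists (Rmin d d'). split; [now apply Rmin_glb_lt|]. intros y Hy.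
  assert (Hy1 := Rlt_le_trans _ _ _ Hy (Rmin_l _ _)).
  assert (Hy2 := Rlt_le_trans _ _ _ Hy (Rmin_r _ _)).
  rewrite <- !E; auto. replace (z - z)%C with (RtoC 0) by ring. rewrite Cmod_0; auto.
Qed.

(** * Continuous functions of a real variable and their integrals *)

(** Componentwise continuity reduces products and inverses to real
    analysis. *)
Definition ccont (f : R -> C) (x : R) : Prop :=
  continuous (fun t => fst (f t)) x /\ continuous (fun t => snd (f t)) x.

Lemma ccont_const c x : ccont (fun _ => c) x.
Proof. split; apply continuous_const. Qed.

Lemma ccont_plus f g x : ccont f x -> ccont g x -> ccont (fun t => f t + g t)%C x.
Proof. intros [] []; split; simpl; apply: continuous_plus; auto. Qed.

Lemma ccont_minus f g x : ccont f x -> ccont g x -> ccont (fun t => f t - g t)%C x.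
Proof. intros [] []; split; simpl; apply: continuous_minus; auto. Qed.

Lemma ccont_mult f g x : ccont f x -> ccont g x -> ccont (fun t => f t * g t)%C x.
Proof.
  intros [] []; split; simpl; [apply: continuous_minus|apply: continuous_plus];
  apply: continuous_mult; auto.
Qed.

Lemma ccont_inv f x : ccont f x -> f x <> RtoC 0 -> ccont (fun t => / f t)%C x.
Proof.
  intros [H1 H2] N.
  assert (Hc : continuous (fun t => / (fst (f t) ^ 2 + snd (f t) ^ 2)) x).
  { apply continuous_Rinv_comp.
    - apply: continuous_plus; simpl; apply: continuous_mult; auto; apply: continuous_mult; auto;
        apply: continuous_const.
    - intros E. apply N. destruct (f x) as [p q]; simpl in *.
      assert (p = 0) by nra. assert (q = 0) by nra. subst; reflexivity. }
  split; simpl; apply: continuous_mult; auto. apply: continuous_opp; auto.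
Qed.

Lemma ccont_pow f n x : ccont f x -> ccont (fun t => f t ^ n)%C x.
Proof.
  intros H. induction n; [exact (ccont_const (RtoC 1) x)|].
  apply (ccont_mult f (fun t => f t ^ n)%C); auto.
Qed.

Lemma ccont_eps f x : ccont f x -> forall eps, 0 < eps -> exists d, 0 < d /\
  forall y, Rabs (y - x) < d -> Cmod (f y - f x) < eps.
Proof.
  intros [H1 H2] eps He.
  assert (E2 : 0 < eps / 2) by lra.
  destruct (proj1 (filterlim_locally _ _) H1 (mkposreal _ E2)) as [d Hd].
  destruct (proj1 (filterlim_locally _ _) H2 (mkposreal _ E2)) as [d' Hd'].
  exists (Rmin d d'). split; [apply Rmin_glb_lt; apply cond_pos|]. intros y Hy.
  assert (Hy1 := Rlt_le_trans _ _ _ Hy (Rmin_l _ _)).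
  assert (Hy2 := Rlt_le_trans _ _ _ Hy (Rmin_r _ _)).
  specialize (Hd y Hy1). specialize (Hd' y Hy2).
  eapply Rle_lt_trans; [apply Cmod_le_abs_sum|].
  change (Rabs (fst (f y) - fst (f x)) < eps/2) in Hd.
  change (Rabs (snd (f y) - snd (f x)) < eps/2) in Hd'.
  simpl. unfold Rminus in *. lra.
Qed.

Lemma ccont_of_eps f x : (forall eps, 0 < eps -> exists d, 0 < d /\
  forall y, Rabs (y - x) < d -> Cmod (f y - f x) < eps) -> ccont f x.
Proof.
  intros H. split; apply filterlim_locally; intros eps;
    destruct (H eps (cond_pos eps)) as [d [Hd Hy]];
  exists (mkposreal d Hd); intros y By; specialize (Hy y By); (eapply Rle_lt_trans;
    [|apply Hy]).
  - apply (fst_le_Cmod (f y - f x)%C).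
  - apply (snd_le_Cmod (f y - f x)%C).
Qed.

Lemma ccont_cdiff F f x : cdiff F (f x) -> ccont f x -> ccont (fun t => F (f t)) x.
Proof.
  intros HF Hf. apply ccont_of_eps. intros eps He.
  destruct (cdiff_continuous _ _ HF eps He) as [d [Hd H]].
  destruct (ccont_eps _ _ Hf d Hd) as [d' [Hd' H']].
  exists d'; split; auto.
Qed.

Definition CInt (f : R -> C) (a b : R) : C :=
  (RInt (fun t => fst (f t)) a b, RInt (fun t => snd (f t)) a b).

Definition ccont_on (f : R -> C) (a b : R) := forall x, a <= x <= b -> ccont f x.

Lemma ex_CInt f a b : a <= b -> ccont_on f a b ->
  ex_RInt (fun t => fst (f t)) a b /\ ex_RInt (fun t => snd (f t)) a b.
Proof.
  intros Hab H. split; apply: ex_RInt_continuous; intros z; rewrite Rmin_left ?Rmax_right; auto;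
    intros Hz; apply (H z Hz).
Qed.

Lemma C_ext (x y : C) : fst x = fst y -> snd x = snd y -> x = y.
Proof. destruct x, y; simpl; intros; subst; auto. Qed.

Lemma CInt_Chasles f a b c : a <= b -> b <= c -> ccont_on f a c ->
  CInt f a c = (CInt f a b + CInt f b c)%C.
Proof.
  intros Hab Hbc H.
  destruct (ex_CInt f a b) as [A1 A2]; auto. { intros x Hx; apply H; lra. }
  destruct (ex_CInt f b c) as [B1 B2]; auto. { intros x Hx; apply H; lra. }
  apply C_ext; simpl; symmetry; apply: RInt_Chasles; auto.
Qed.

Lemma CInt_minus f g a b : a <= b -> ccont_on f a b -> ccont_on g a b ->
  CInt (fun t => f t - g t)%C a b = (CInt f a b - CInt g a b)%C.
Proof.
  intros Hab Hf Hg. destruct (ex_CInt f a b) as [A1 A2]; auto.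
  destruct (ex_CInt g a b) as [B1 B2]; auto.
  apply C_ext; simpl; apply: RInt_minus; auto.
Qed.

Lemma CInt_plus f g a b : a <= b -> ccont_on f a b -> ccont_on g a b ->
  CInt (fun t => f t + g t)%C a b = (CInt f a b + CInt g a b)%C.
Proof.
  intros Hab Hf Hg. destruct (ex_CInt f a b) as [A1 A2]; auto.
  destruct (ex_CInt g a b) as [B1 B2]; auto.
  apply C_ext; simpl; apply: RInt_plus; auto.
Qed.

Lemma CInt_scal c f a b : a <= b -> ccont_on f a b ->
  CInt (fun t => c * f t)%C a b = (c * CInt f a b)%C.
Proof.
  intros Hab Hf. destruct (ex_CInt f a b) as [A1 A2]; auto.
  assert (S : forall (k : R) h, ex_RInt h a b -> RInt (fun t => k * h t) a b = k * RInt h a b).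
  { intros k h Hh. apply: RInt_scal; auto. }
  assert (X : forall (k : R) h, ex_RInt h a b -> ex_RInt (fun t => k * h t) a b).
  { intros k h Hh. apply: ex_RInt_scal; auto. }
  apply C_ext; simpl.
  - rewrite <- !S by auto. apply: RInt_minus; auto.
  - rewrite <- !S by auto. apply: RInt_plus; auto.
Qed.

Lemma CInt_ext f g a b : a <= b -> (forall x, a <= x <= b -> f x = g x) ->
  CInt f a b = CInt g a b.
Proof.
  intros Hab H. apply C_ext; simpl; apply RInt_ext; intros x; rewrite Rmin_left ?Rmax_right;
    auto; intros Hx; rewrite H; auto; lra.
Qed.

(** The factor 2 is the price of bounding the two components separately. *)
Lemma CInt_bound f a b M : a <= b -> ccont_on f a b -> (forall x, a <= x <= b ->
  Cmod (f x) <= M) ->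
  Cmod (CInt f a b) <= 2 * M * (b - a).
Proof.
  intros Hab Hf HM. destruct (ex_CInt f a b) as [A1 A2]; auto.
  eapply Rle_trans; [apply Cmod_le_abs_sum|]. simpl.
  assert (Rabs (RInt (fun t => fst (f t)) a b) <= (b - a) * M).
  { apply abs_RInt_le_const; auto. intros t Ht. eapply Rle_trans; [apply fst_le_Cmod|auto]. }
  assert (Rabs (RInt (fun t => snd (f t)) a b) <= (b - a) * M).
  { apply abs_RInt_le_const; auto. intros t Ht. eapply Rle_trans; [apply snd_le_Cmod|auto]. }
  lra.
Qed.

Definition cderive (f : R -> C) (x : R) (l : C) :=
  is_derive (fun t => fst (f t)) x (fst l) /\ is_derive (fun t => snd (f t)) x (snd l).

Lemma CInt_derive f df a b : a <= b -> (forall x, a <= x <= b -> cderive f x (df x)) ->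
  ccont_on df a b -> CInt df a b = (f b - f a)%C.
Proof.
  intros Hab Hd Hc. apply C_ext; simpl; apply is_RInt_unique.
  - apply: (is_RInt_derive (fun t => fst (f t))); intros x; rewrite Rmin_left ?Rmax_right; auto;
      intros Hx; [apply Hd|apply Hc]; auto.
  - apply: (is_RInt_derive (fun t => snd (f t))); intros x; rewrite Rmin_left ?Rmax_right; auto;
      intros Hx; [apply Hd|apply Hc]; auto.
Qed.

Lemma CInt_const c a b : a <= b -> CInt (fun _ => c) a b = (RtoC (b - a) * c)%C.
Proof.
  intros. apply C_ext; simpl; rewrite RInt_const; unfold scal; simpl; unfold mult; simpl; ring.
Qed.

(** * Goursat's bisection *)

Definition half_of (I J : R * R) : Prop :=
  J = (fst I, (fst I + snd I) / 2) \/ J = ((fst I + snd I) / 2, snd I).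

Lemma nested_halves (u : nat -> R * R) :
  fst (u O) <= snd (u O) -> (forall n, half_of (u n) (u (S n))) ->
  exists p, forall n, fst (u n) <= p <= snd (u n) /\
    snd (u n) - fst (u n) = (snd (u O) - fst (u O)) / 2 ^ n.
Proof.
  intros H0 Hh.
  assert (Hlen : forall n, snd (u n) - fst (u n) = (snd (u O) - fst (u O)) / 2 ^ n).
  { induction n as [|n IH]; [simpl; lra|].
    assert (Hp : 2 ^ n <> 0) by (apply pow_nonzero; lra).
    replace ((snd (u O) - fst (u O)) / 2 ^ S n) with ((snd (u n) - fst (u n)) / 2)
      by (rewrite IH; simpl; field; auto).
    destruct (Hh n) as [E|E]; rewrite E; simpl; lra. }
  assert (Hle : forall n, fst (u n) <= snd (u n)).
  { intros n. assert (0 <= (snd (u O) - fst (u O)) / 2 ^ n).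
    { apply Rdiv_le_0_compat; [lra|apply pow_lt; lra]. }
    specialize (Hlen n). lra. }
  assert (Hmono : forall n k, fst (u n) <= fst (u (n + k)%nat) /\ snd (u (n + k)%nat) <= snd (u
    n)).
  { intros n; induction k as [|k IH]; [rewrite Nat.add_0_r; lra|].
    rewrite Nat.add_succ_r. specialize (Hle (n + k)%nat).
    destruct (Hh (n + k)%nat) as [E|E]; rewrite E; simpl; lra. }
  destruct (completeness (fun x => exists n, x = fst (u n))) as [p [Hub Hlub]].
  - exists (snd (u O)). intros x [n ->]. destruct (Hmono O n) as [_ H]. specialize (Hle n).
    simpl in H. lra.
  - exists (fst (u O)). now exists O.
  - exists p. intros n. split; [|apply Hlen]. split.
    + apply Hub. now exists n.
    + apply Hlub. intros x [m ->].
      destruct (Hmono n m) as [_ H1]. destruct (Hmono m n) as [H2 _].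
      rewrite Nat.add_comm in H2. specialize (Hle (n + m)%nat). lra.
Qed.

Lemma geometric_small K0 x r eps : 0 <= K0 -> 0 <= x < r -> 0 < eps ->
  exists N, forall n, (N <= n)%nat -> K0 * (x / r) ^ n < eps.
Proof.
  intros HK Hx He.
  assert (Hq : 0 <= x / r < 1).
  { split; [apply Rdiv_le_0_compat; lra|]. apply Rmult_lt_reg_r with r; [lra|].
    replace (x / r * r) with x; [lra|field; lra]. }
  destruct (pow_lt_1_zero (x / r)) with (y := eps / (1 + K0)) as [N HN].
  { rewrite Rabs_pos_eq; lra. }
  { apply Rdiv_lt_0_compat; lra. }
  exists N. intros n Hn. specialize (HN n Hn).
  rewrite Rabs_pos_eq in HN; [|now apply pow_le].
  apply Rle_lt_trans with (K0 * (eps / (1 + K0))); [apply Rmult_le_compat_l; lra|].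
  replace (K0 * (eps / (1 + K0))) with (eps - eps / (1 + K0)) by (field; lra).
  assert (0 < eps / (1 + K0)) by (apply Rdiv_lt_0_compat; lra). lra.
Qed.

Lemma rect_bisection (Bad : R * R -> R * R -> Prop) (I0 J0 : R * R) :
  fst I0 <= snd I0 -> fst J0 <= snd J0 -> Bad I0 J0 ->
  (forall I J, fst I0 <= fst I <= snd I -> snd I <= snd I0 ->
     fst J0 <= fst J <= snd J -> snd J <= snd J0 -> Bad I J ->
     exists I' J', half_of I I' /\ half_of J J' /\ Bad I' J') ->
  exists s t, fst I0 <= s <= snd I0 /\ fst J0 <= t <= snd J0 /\
    forall d, 0 < d -> exists I J, Bad I J /\
      fst I0 <= fst I <= s /\ s <= snd I <= snd I0 /\ snd I - fst I < d /\
      fst J0 <= fst J <= t /\ t <= snd J <= snd J0 /\ snd J - fst J < d.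
Proof.
  intros HI HJ HB Hstep.
  set (ok := fun q : (R * R) * (R * R) =>
    fst I0 <= fst (fst q) <= snd (fst q) /\ snd (fst q) <= snd I0 /\
    fst J0 <= fst (snd q) <= snd (snd q) /\ snd (snd q) <= snd J0 /\ Bad (fst q) (snd q)).
  assert (Hnext : forall q : {q | ok q}, {q' : {q | ok q} |
    half_of (fst (proj1_sig q)) (fst (proj1_sig q')) /\ half_of (snd (proj1_sig q)) (snd
      (proj1_sig q'))}).
  { intros [[I J] (H1 & H2 & H3 & H4 & H5)]; simpl in *.
    apply constructive_indefinite_description.
    destruct (Hstep I J) as (I' & J' & HI' & HJ' & HB'); auto.
    assert (O : ok (I', J')).
    { unfold ok; simpl.
      destruct HI' as [->| ->]; destruct HJ' as [->| ->]; simpl; repeat split; try lra; auto. }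
    exists (exist _ (I', J') O). simpl; auto. }
  assert (O0 : ok (I0, J0)) by (unfold ok; simpl; repeat split; auto; lra).
  set (u := fun n => Nat.iter n (fun q => proj1_sig (Hnext q)) (exist ok (I0, J0) O0)).
  destruct (nested_halves (fun n => fst (proj1_sig (u n)))) as [s Hs]; auto.
  { intros n. apply (proj2_sig (Hnext (u n))). }
  destruct (nested_halves (fun n => snd (proj1_sig (u n)))) as [t Ht]; auto.
  { intros n. apply (proj2_sig (Hnext (u n))). }
  simpl in Hs, Ht.
  exists s, t. split; [apply (Hs O)|]. split; [apply (Ht O)|].
  intros d Hd.
  destruct (geometric_small ((snd I0 - fst I0) + (snd J0 - fst J0)) 1 2 d) as [n Hn]; try lra.
  specialize (Hn n (le_n _)). rewrite Rdiv_1_l pow_inv in Hn.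
  assert (Hp : 0 < 2 ^ n) by (apply pow_lt; lra).
  assert (G1 : 0 <= (snd I0 - fst I0) / 2 ^ n) by (apply Rdiv_le_0_compat; lra).
  assert (G2 : 0 <= (snd J0 - fst J0) / 2 ^ n) by (apply Rdiv_le_0_compat; lra).
  rewrite Rmult_plus_distr_r in Hn. fold (Rdiv (snd I0 - fst I0) (2 ^ n)) in Hn.
  fold (Rdiv (snd J0 - fst J0) (2 ^ n)) in Hn.
  destruct (Hs n) as [Hs1 Hs2]. destruct (Ht n) as [Ht1 Ht2].
  destruct (proj2_sig (u n)) as (H1 & H2 & H3 & H4 & H5).
  exists (fst (proj1_sig (u n))), (snd (proj1_sig (u n))).
  repeat split; auto; lra.
Qed.

(** If the value on a rectangle of half-perimeter [L] is nonzero, then it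
    exceeds [eta L ^ 2] for some [eta > 0].  By additivity one of the four
    quarters satisfies the same inequality, since the quarters have
    half-perimeter [L / 2]; bisecting forever contradicts the local bound at
    the limit point. *)
Lemma goursat_additive (A : R -> R -> R -> R -> C) a b c d :
  a <= b -> c <= d ->
  (forall s1 s2 s3 t1 t2, a <= s1 <= s2 -> s2 <= s3 <= b -> c <= t1 <= t2 -> t2 <= d ->
     A s1 s3 t1 t2 = (A s1 s2 t1 t2 + A s2 s3 t1 t2)%C) ->
  (forall s1 s2 t1 t2 t3, a <= s1 <= s2 -> s2 <= b -> c <= t1 <= t2 -> t2 <= t3 <= d ->
     A s1 s2 t1 t3 = (A s1 s2 t1 t2 + A s1 s2 t2 t3)%C) ->
  (forall s t, a <= s <= b -> c <= t <= d -> forall eps, 0 < eps -> exists dl, 0 < dl /\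
     forall s1 s2 t1 t2, a <= s1 <= s -> s <= s2 <= b -> c <= t1 <= t -> t <= t2 <= d ->
       s2 - s1 < dl -> t2 - t1 < dl ->
       Cmod (A s1 s2 t1 t2) <= eps * ((s2 - s1) + (t2 - t1)) ^ 2) ->
  A a b c d = RtoC 0.
Proof.
  intros Hab Hcd Hadd1 Hadd2 Hloc.
  destruct (Req_dec (Cmod (A a b c d)) 0) as [E|NE]; [now apply Cmod_eq_0|exfalso].
  assert (HA : 0 < Cmod (A a b c d)) by (generalize (Cmod_ge_0 (A a b c d)); lra).
  set (L := (b - a) + (d - c)).
  assert (HL : 0 < 1 + L ^ 2) by (generalize (pow2_ge_0 L); lra).
  (* The 1 makes the initial inequality strict, also when L = 0. *)
  set (eta := Cmod (A a b c d) / (1 + L ^ 2)).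
  assert (Heta : 0 < eta) by (apply Rdiv_lt_0_compat; auto).
  set (Bad := fun I J : R * R => eta * ((snd I - fst I) + (snd J - fst J)) ^ 2
     < Cmod (A (fst I) (snd I) (fst J) (snd J))).
  destruct (rect_bisection Bad (a, b) (c, d)) as (s & t & Hs & Ht & H); simpl; auto.
  - unfold Bad; simpl fst; simpl snd. fold L.
    replace (Cmod (A a b c d)) with (eta * (1 + L ^ 2)) by (unfold eta; field; lra). nra.
  - intros [s1 s2] [t1 t2]; simpl. intros H1 H2 H3 H4 HB.
    apply NNPP. intros N.
    set (s := (s1 + s2) / 2). set (t := (t1 + t2) / 2).
    assert (Hq : forall I J, half_of (s1, s2) I -> half_of (t1, t2) J ->
      Cmod (A (fst I) (snd I) (fst J) (snd J)) <= eta * (((s2 - s1) + (t2 - t1)) / 2) ^ 2).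
    { intros I J HI HJ. apply Rnot_lt_le. intros HH. apply N. exists I, J. split; auto.
      split; auto.
      unfold Bad. destruct HI as [->| ->]; destruct HJ as [->| ->]; simpl fst in *;
        simpl snd in *;
      (match goal with |- ?e * ?x ^ 2 < _ => replace x with ((s2 - s1 + (t2 - t1)) / 2)
        by (simpl; lra) end); exact HH. }
    assert (Q1 := Hq (s1, s) (t1, t) (or_introl eq_refl) (or_introl eq_refl)).
    assert (Q2 := Hq (s, s2) (t1, t) (or_intror eq_refl) (or_introl eq_refl)).
    assert (Q3 := Hq (s1, s) (t, t2) (or_introl eq_refl) (or_intror eq_refl)).
    assert (Q4 := Hq (s, s2) (t, t2) (or_intror eq_refl) (or_intror eq_refl)).
    unfold Bad in HB. simpl fst in *; simpl snd in *.
    rewrite (Hadd2 s1 s2 t1 t t2) in HB; try (unfold s, t; lra).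
    rewrite (Hadd1 s1 s s2 t1 t) in HB; try (unfold s, t; lra).
    rewrite (Hadd1 s1 s s2 t t2) in HB; try (unfold s, t; lra).
    assert (T1 := Cmod_triangle (A s1 s t1 t + A s s2 t1 t) (A s1 s t t2 + A s s2 t t2)).
    assert (T2 := Cmod_triangle (A s1 s t1 t) (A s s2 t1 t)).
    assert (T3 := Cmod_triangle (A s1 s t t2) (A s s2 t t2)).
    replace ((((s2 - s1) + (t2 - t1)) / 2) ^ 2) with (((s2 - s1) + (t2 - t1)) ^ 2 / 4) in *
      by field.
    lra.
  - destruct (Hloc s t Hs Ht eta Heta) as (dl & Hdl & Hl).
    destruct (H dl Hdl) as ([s1 s2] & [t1 t2] & HB & Hr). simpl in Hr. unfold Bad in HB.
    simpl fst in *; simpl snd in *.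
    assert (Hc : Cmod (A s1 s2 t1 t2) <= eta * ((s2 - s1) + (t2 - t1)) ^ 2) by (apply Hl; lra).
    lra.
Qed.

(** * Cauchy's formula *)

Definition circ (r th : R) : C := (r * cos th, r * sin th).
Definition dcirc (r th : R) : C := (- (r * sin th), r * cos th).

(** The angular part of the logarithmic form [dz / (z - w)], which is the same
    on all the circles of [shrink r w]. *)
Definition kernel (r : R) (w : C) (th : R) : C := (dcirc r th / (circ r th - w))%C.

(** The circle of radius [r], contracted towards [w] by the factor [t]. *)
Definition shrink (r : R) (w : C) (t th : R) : C := (w + t * (circ r th - w))%C.

Lemma Cmod_circ r th : 0 <= r -> Cmod (circ r th) = r.
Proof.
  intros Hr. unfold Cmod, circ; simpl fst; simpl snd.
  replace ((r * cos th) ^ 2 + (r * sin th) ^ 2) with (r ^ 2).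
  - apply sqrt_pow2; auto.
  - generalize (sin2_cos2 th). unfold Rsqr. nra.
Qed.

Lemma Cmod_dcirc r th : 0 <= r -> Cmod (dcirc r th) = r.
Proof.
  intros Hr. unfold Cmod, dcirc; simpl fst; simpl snd.
  replace ((- (r * sin th)) ^ 2 + (r * cos th) ^ 2) with (r ^ 2).
  - apply sqrt_pow2; auto.
  - generalize (sin2_cos2 th). unfold Rsqr. nra.
Qed.

Lemma ccont_of_derive f x l : cderive f x l -> ccont f x.
Proof.
  intros [H1 H2]; split.
  - apply (ex_derive_continuous (fun t => fst (f t))). eexists; apply H1.
  - apply (ex_derive_continuous (fun t => snd (f t))). eexists; apply H2.
Qed.

Lemma cderive_circ r th : cderive (circ r) th (dcirc r th).
Proof. split; simpl; auto_derive; auto; ring. Qed.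

Lemma ccont_circ r th : ccont (circ r) th.
Proof. eapply ccont_of_derive, cderive_circ. Qed.

Lemma ccont_dcirc r th : ccont (dcirc r) th.
Proof. apply (ccont_of_derive _ _ (- (r * cos th), - (r * sin th))).
  split; simpl; auto_derive; auto; ring. Qed.

Lemma CInt_dcirc r a b : a <= b -> CInt (dcirc r) a b = (circ r b - circ r a)%C.
Proof.
  intros H. apply CInt_derive; auto.
  - intros; apply cderive_circ.
  - intros x _; apply ccont_dcirc.
Qed.

Lemma circ_lipschitz_le r a b : 0 <= r -> a <= b ->
  Cmod (circ r b - circ r a) <= 2 * r * (b - a).
Proof.
  intros Hr H. rewrite -(CInt_dcirc _ _ _ H). apply CInt_bound; auto.
  - intros x _; apply ccont_dcirc.
  - intros; rewrite Cmod_dcirc; lra.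
Qed.

Lemma circ_lipschitz r a b : 0 <= r -> Cmod (circ r b - circ r a) <= 2 * r * Rabs (b - a).
Proof.
  intros Hr. destruct (Rle_dec a b) as [H|H].
  - rewrite Rabs_pos_eq; [|lra]. now apply circ_lipschitz_le.
  - rewrite Cmod_minus_sym Rabs_minus_sym Rabs_pos_eq; [|lra]. apply circ_lipschitz_le; lra.
Qed.

Lemma circ_minus_ge r w th : 0 <= r -> r - Cmod w <= Cmod (circ r th - w).
Proof. intros Hr. rewrite -{1}(Cmod_circ r th Hr). apply Cmod_minus_ge. Qed.

Lemma circ_minus_neq r w th : Cmod w < r -> (circ r th - w)%C <> RtoC 0.
Proof.
  intros Hw E. assert (H := circ_minus_ge r w th). rewrite E Cmod_0 in H.
  generalize (Cmod_ge_0 w); intros. lra.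
Qed.

Lemma ccont_kernel r w th : Cmod w < r -> ccont (kernel r w) th.
Proof.
  intros Hw. apply ccont_mult; [apply ccont_dcirc|].
  apply (ccont_inv (fun th => circ r th - w)%C); [|now apply circ_minus_neq].
  apply ccont_minus; [apply ccont_circ|apply ccont_const].
Qed.

Lemma kernel_bound r w th : Cmod w < r -> Cmod (kernel r w th) <= r / (r - Cmod w).
Proof.
  intros Hw. assert (H0 := Cmod_ge_0 w). unfold kernel.
  rewrite Cmod_div; [|now apply circ_minus_neq]. rewrite Cmod_dcirc; [|lra].
  apply Rmult_le_compat_l; [lra|]. apply Rinv_le_contravar; [lra|]. apply circ_minus_ge; lra.
Qed.

Lemma shrink_bound r w t th : Cmod w < r -> 0 <= t <= 1 -> Cmod (shrink r w t th) <= r.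
Proof.
  intros Hw Ht. assert (H0 := Cmod_ge_0 w). unfold shrink.
  replace (w + t * (circ r th - w))%C with (RtoC (1 - t) * w + t * circ r th)%C.
  2: { rewrite RtoC_minus. ring. }
  eapply Rle_trans; [apply Cmod_triangle|].
  rewrite !Cmod_mult !Cmod_R Cmod_circ; [|lra]. rewrite !Rabs_pos_eq; try lra. nra.
Qed.

Lemma ccont_RtoC t : ccont RtoC t.
Proof. split; [apply continuous_id|apply continuous_const]. Qed.

Lemma ccont_shrink_t r w th t : ccont (fun t => shrink r w t th) t.
Proof.
  apply ccont_plus; [apply ccont_const|].
  apply ccont_mult; [apply ccont_RtoC|apply ccont_const].
Qed.

Lemma ccont_shrink_th r w th t : ccont (fun th => shrink r w t th) th.
Proof.
  apply ccont_plus; [apply ccont_const|]. apply ccont_mult; [apply ccont_const|].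
  apply ccont_minus; [apply ccont_circ|apply ccont_const].
Qed.

(** The pullback of [F z dz / (z - w)] under [shrink r w] has the angular
    component [pull_angle] and the radial component [pull_radius]. *)
Definition pull_angle (F : C -> C) r w (t th : R) : C :=
  (F (shrink r w t th) * kernel r w th)%C.

Definition pull_radius (F : C -> C) r w (th t : R) : C :=
  (F (shrink r w t th) * / RtoC t)%C.

(** The integral of that pullback along the boundary of the parameter rectangle
    [t1, t2] x [th1, th2]. *)
Definition boundary_integral F r w t1 t2 th1 th2 : C :=
  ((CInt (pull_angle F r w t2) th1 th2 - CInt (pull_angle F r w t1) th1 th2)
   - (CInt (pull_radius F r w th2) t1 t2 - CInt (pull_radius F r w th1) t1 t2))%C.

Definition cdiff_disc (F : C -> C) (R0 : R) := forall z, Cmod z < R0 -> cdiff F z.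

Lemma ccont_pull_angle F r w t th R0 : cdiff_disc F R0 -> Cmod w < r -> r < R0 -> 0 <= t <= 1 ->
  ccont (pull_angle F r w t) th.
Proof.
  intros HF Hw Hr Ht. apply ccont_mult; [|now apply ccont_kernel].
  apply ccont_cdiff; [|apply ccont_shrink_th]. apply HF.
  eapply Rle_lt_trans; [apply shrink_bound|]; auto.
Qed.

Lemma ccont_pull_radius F r w t th R0 : cdiff_disc F R0 -> Cmod w < r -> r < R0 -> 0 < t <= 1 ->
  ccont (pull_radius F r w th) t.
Proof.
  intros HF Hw Hr Ht. apply ccont_mult.
  - apply (ccont_cdiff F (fun t => shrink r w t th)); [|apply ccont_shrink_t]. apply HF.
    eapply Rle_lt_trans; [apply shrink_bound|]; auto. lra.
  - apply (ccont_inv RtoC); [apply ccont_RtoC|]. intros E. apply RtoC_inj in E. lra.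
Qed.

Lemma boundary_integral_minus F G r w t1 t2 th1 th2 R0 : cdiff_disc F R0 -> cdiff_disc G R0 ->
  Cmod w < r -> r < R0 -> 0 < t1 <= t2 -> t2 <= 1 -> th1 <= th2 ->
  boundary_integral (fun z => F z - G z)%C r w t1 t2 th1 th2
  = (boundary_integral F r w t1 t2 th1 th2 - boundary_integral G r w t1 t2 th1 th2)%C.
Proof.
  intros HF HG Hw Hr H1 H2 H3.
  assert (HQ : forall t, 0 < t <= 1 -> CInt (pull_angle (fun z => F z - G z)%C r w t) th1 th2
     = (CInt (pull_angle F r w t) th1 th2 - CInt (pull_angle G r w t) th1 th2)%C).
  { intros t Ht. rewrite -CInt_minus; auto.
    - apply CInt_ext; auto. intros; unfold pull_angle; ring.
    - intros x _. eapply ccont_pull_angle; eauto; lra.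
    - intros x _. eapply ccont_pull_angle; eauto; lra. }
  assert (HP : forall th, CInt (pull_radius (fun z => F z - G z)%C r w th) t1 t2
     = (CInt (pull_radius F r w th) t1 t2 - CInt (pull_radius G r w th) t1 t2)%C).
  { intros th. rewrite -CInt_minus; try lra.
    - apply CInt_ext; try lra. intros; unfold pull_radius; ring.
    - intros x Hx. eapply ccont_pull_radius; eauto; lra.
    - intros x Hx. eapply ccont_pull_radius; eauto; lra. }
  unfold boundary_integral. rewrite !HP !HQ; try lra. ring.
Qed.

Lemma cdiff_disc_affine p q R0 : cdiff_disc (fun z => p + q * z)%C R0.
Proof.
  intros z _. apply (cdiff_affine_comp (fun x => x) p q).
  apply (cdiff_ext_loc (fun x => x ^ 1)%C _ _ 1); [lra| |apply cdiff_pow].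
  intros y _. simpl. ring.
Qed.

(** With [F z = (p + q w) + q (z - w)], the form is the sum of a multiple of
    [dt / t + kernel dth], whose components depend on one variable each, and
    of the exact form [q dz]. *)
Lemma boundary_integral_affine p q r w t1 t2 th1 th2 : Cmod w < r -> 0 < t1 <= t2 -> t2 <= 1 ->
  th1 <= th2 ->
  boundary_integral (fun z => p + q * z)%C r w t1 t2 th1 th2 = RtoC 0.
Proof.
  intros Hw H1 H2 H3. assert (HA := cdiff_disc_affine p q (r + 1)).
  unfold boundary_integral. rewrite -!CInt_minus; try lra.
  - rewrite (CInt_ext _ (fun th => (q * RtoC (t2 - t1)) * dcirc r th)%C th1); auto.
    2: { intros th _. unfold pull_angle, kernel, shrink. rewrite RtoC_minus. field.
    now apply circ_minus_neq. }
    rewrite (CInt_ext _ (fun t => q * (circ r th2 - circ r th1))%C t1); try lra.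
    2: { intros t Ht. unfold pull_radius, shrink. field. intros E. apply RtoC_inj in E. lra. }
    rewrite CInt_const; [|lra]. rewrite CInt_scal; auto.
    + rewrite CInt_dcirc; auto. rewrite RtoC_minus. ring.
    + intros x _; apply ccont_dcirc.
  - intros x Hx. eapply ccont_pull_radius; eauto; lra.
  - intros x Hx. eapply ccont_pull_radius; eauto; lra.
  - intros x Hx. eapply ccont_pull_angle; eauto; lra.
  - intros x Hx. eapply ccont_pull_angle; eauto; lra.
Qed.

Lemma boundary_integral_bound F r w t1 t2 th1 th2 R0 M K0 : cdiff_disc F R0 ->
  Cmod w < r -> r < R0 -> 0 < t1 <= t2 -> t2 <= 1 -> th1 <= th2 ->
  r / (r - Cmod w) <= K0 -> / t1 <= K0 ->
  (forall t th, t1 <= t <= t2 -> th1 <= th <= th2 -> Cmod (F (shrink r w t th)) <= M) ->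
  Cmod (boundary_integral F r w t1 t2 th1 th2) <= 4 * M * K0 * ((t2 - t1) + (th2 - th1)).
Proof.
  intros HF Hw Hr H1 H2 H3 HK1 HK2 HM.
  assert (M0 : 0 <= M) by (eapply Rle_trans; [apply Cmod_ge_0|apply (HM t1 th1); lra]).
  assert (HQ : forall t, t1 <= t <= t2 ->
    Cmod (CInt (pull_angle F r w t) th1 th2) <= 2 * (M * K0) * (th2 - th1)).
  { intros t Ht. apply CInt_bound; auto.
    - intros x _. eapply ccont_pull_angle; eauto; lra.
    - intros x Hx. unfold pull_angle. rewrite Cmod_mult.
      apply Rmult_le_compat; try apply Cmod_ge_0; auto.
      eapply Rle_trans; [now apply kernel_bound|auto]. }
  assert (HP : forall th, th1 <= th <= th2 ->
    Cmod (CInt (pull_radius F r w th) t1 t2) <= 2 * (M * K0) * (t2 - t1)).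
  { intros th Hth. apply CInt_bound; try lra.
    - intros x Hx. eapply ccont_pull_radius; eauto; lra.
    - intros x Hx. unfold pull_radius. rewrite Cmod_mult.
      apply Rmult_le_compat; try apply Cmod_ge_0; auto.
      rewrite Cmod_inv; [|intros E; apply RtoC_inj in E; lra].
      rewrite Cmod_R Rabs_pos_eq; [|lra].
      eapply Rle_trans; [apply Rinv_le_contravar|apply HK2]; lra. }
  unfold boundary_integral.
  assert (A1 := HQ t1). assert (A2 := HQ t2). assert (A3 := HP th1). assert (A4 := HP th2).
  eapply Rle_trans; [apply Cmod_minus_le|].
  assert (T1 := Cmod_minus_le (CInt (pull_angle F r w t2) th1 th2)
    (CInt (pull_angle F r w t1) th1 th2)).
  assert (T2 := Cmod_minus_le (CInt (pull_radius F r w th2) t1 t2)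
    (CInt (pull_radius F r w th1) t1 t2)).
  lra.
Qed.

(** Near a point, [F] is affine up to an error [o(|z - z0|)].  The affine part
    contributes nothing, and the error contributes [o(D ^ 2)] on a rectangle
    of half-perimeter [D], so that [goursat_additive] applies. *)
Lemma boundary_integral_zero F r w t0 th0 R0 : cdiff_disc F R0 -> Cmod w < r -> r < R0 ->
  0 < t0 <= 1 -> 0 <= th0 ->
  boundary_integral F r w t0 1 0 th0 = RtoC 0.
Proof.
  intros HF Hw Hr Ht0 Hth0.
  assert (H0 := Cmod_ge_0 w).
  apply (goursat_additive (boundary_integral F r w)); try lra.
  - intros s1 s2 s3 t1 t2 H1 H2 H3 H4. unfold boundary_integral.
    rewrite (CInt_Chasles (pull_radius F r w t2) s1 s2 s3); try lra.
    2: { intros x Hx. eapply ccont_pull_radius; eauto; lra. }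
    rewrite (CInt_Chasles (pull_radius F r w t1) s1 s2 s3); try lra.
    2: { intros x Hx. eapply ccont_pull_radius; eauto; lra. }
    ring.
  - intros s1 s2 t1 t2 t3 H1 H2 H3 H4. unfold boundary_integral.
    rewrite (CInt_Chasles (pull_angle F r w s1) t1 t2 t3); try lra.
    2: { intros x Hx. eapply ccont_pull_angle; eauto; lra. }
    rewrite (CInt_Chasles (pull_angle F r w s2) t1 t2 t3); try lra.
    2: { intros x Hx. eapply ccont_pull_angle; eauto; lra. }
    ring.
  - intros s th Hs Hth eps Heps.
    set (z0 := shrink r w s th).
    assert (Hz0 : Cmod z0 < R0).
    { eapply Rle_lt_trans; [apply shrink_bound|]; auto; lra. }
    destruct (HF z0 Hz0) as [l Hl].
    set (K0 := r / (r - Cmod w) + / t0).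
    assert (K1 : 0 < r / (r - Cmod w)) by (apply Rdiv_lt_0_compat; lra).
    assert (K2 : 0 < / t0) by (apply Rinv_0_lt_compat; lra).
    assert (HK0 : 0 < 8 * r * K0) by (unfold K0; apply Rmult_lt_0_compat; lra).
    destruct (Hl (eps / (8 * r * K0))) as [d [Hd H]]; [apply Rdiv_lt_0_compat; auto|].
    exists (d / (4 * r)). split; [apply Rdiv_lt_0_compat; lra|].
    intros s1 s2 t1 t2 H1 H2 H3 H4 H5 H6.
    set (D := (s2 - s1) + (t2 - t1)).
    assert (HD0 : 0 <= D) by (unfold D; lra).
    assert (Hdist : forall u v, s1 <= u <= s2 -> t1 <= v <= t2 ->
      Cmod (shrink r w u v - z0)%C <= 2 * r * D).
    { intros u v Hu Hv. unfold z0, shrink.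
      replace (w + u * (circ r v - w) - (w + s * (circ r th - w)))%C
        with (RtoC (u - s) * (circ r v - w) + s * (circ r v - circ r th))%C
        by (rewrite RtoC_minus; ring).
      eapply Rle_trans; [apply Cmod_triangle|]. rewrite !Cmod_mult !Cmod_R.
      rewrite (Rabs_pos_eq s); [|lra].
      assert (A1 : Cmod (circ r v - w) <= 2 * r).
      { eapply Rle_trans; [apply Cmod_minus_le|]. rewrite Cmod_circ; lra. }
      assert (A2 := circ_lipschitz r th v).
      assert (A3 : Rabs (u - s) <= s2 - s1) by (apply Rabs_le; lra).
      assert (A4 : Rabs (v - th) <= t2 - t1) by (apply Rabs_le; lra).
      assert (A5 := Rabs_pos (u - s)). assert (A6 := Rabs_pos (v - th)).
      assert (A7 := Cmod_ge_0 (circ r v - w)). assert (A8 := Cmod_ge_0 (circ r v - circ r th)).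
      assert (B1 : Rabs (u - s) * Cmod (circ r v - w) <= (s2 - s1) * (2 * r))
        by (apply Rmult_le_compat; auto).
      assert (B2 : s * Cmod (circ r v - circ r th) <= 1 * Cmod (circ r v - circ r th))
        by (apply Rmult_le_compat_r; lra).
      assert (B3 : 2 * r * Rabs (v - th) <= 2 * r * (t2 - t1))
        by (apply Rmult_le_compat_l; lra).
      unfold D. lra. }
    assert (HDd : 2 * r * D < d).
    { apply Rlt_le_trans with (2 * r * (2 * (d / (4 * r)))).
      - apply Rmult_lt_compat_l; unfold D; lra.
      - right; field; lra. }
    (* The first-order Taylor polynomial of F at z0. *)
    set (G := fun z => ((F z0 - l * z0) + l * z)%C).
    assert (HG : cdiff_disc G R0) by apply cdiff_disc_affine.
    assert (E := boundary_integral_minus F G r w s1 s2 t1 t2 R0 HF HG Hw Hr).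
    unfold G at 2 in E. rewrite boundary_integral_affine in E; try lra.
    replace (boundary_integral F r w s1 s2 t1 t2)
      with (boundary_integral (fun z => F z - G z)%C r w s1 s2 t1 t2).
    2: { rewrite E; try lra. ring. }
    replace (eps * D ^ 2) with (4 * (eps / (8 * r * K0) * (2 * r * D)) * K0 * D).
    2: { field. split; [unfold K0; lra|lra]. }
    eapply boundary_integral_bound; eauto; try lra.
    + intros z Hz. apply cdiff_minus; auto.
    + unfold K0; lra.
    + apply Rle_trans with (/ t0); [|unfold K0; lra]. apply Rinv_le_contravar; lra.
    + intros u v Hu Hv. specialize (Hdist u v Hu Hv).
      assert (HH : Cmod (shrink r w u v - z0) < d) by lra.
      specialize (H _ HH). unfold G.
      replace (F (shrink r w u v) - (F z0 - l * z0 + l * shrink r w u v))%C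
       with (F (shrink r w u v) - F z0 - l * (shrink r w u v - z0))%C by ring.
      eapply Rle_trans; [apply H|]. apply Rmult_le_compat_l; auto.
      apply Rlt_le, Rdiv_lt_0_compat; lra.
Qed.

Lemma circ_2PI r : circ r (2 * PI) = circ r 0.
Proof. unfold circ. now rewrite cos_2PI sin_2PI cos_0 sin_0. Qed.

(** The two radial sides of [t, 1] x [0, 2 pi] cancel by periodicity, so the
    integral over the contracted circle does not depend on [t].  Letting [t]
    tend to 0 replaces [F] by its value at the limit point [w]. *)
Lemma cauchy_formula F r w R0 : cdiff_disc F R0 -> Cmod w < r -> r < R0 ->
  CInt (fun th => F (circ r th) * kernel r w th)%C 0 (2 * PI)
  = CInt (fun th => F w * kernel r w th)%C 0 (2 * PI).
Proof.
  intros HF Hw Hr. assert (HPI := PI_RGT_0). assert (H0 := Cmod_ge_0 w).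
  set (I1 := CInt _ _ _). set (I2 := CInt _ _ _).
  assert (Hconst : forall t, 0 < t <= 1 -> CInt (pull_angle F r w t) 0 (2 * PI) = I1).
  { intros t Ht. assert (G := boundary_integral_zero F r w t (2 * PI) R0 HF Hw Hr Ht).
    unfold boundary_integral in G.
    assert (EP : CInt (pull_radius F r w (2 * PI)) t 1 = CInt (pull_radius F r w 0) t 1).
    { apply CInt_ext; [lra|]. intros; unfold pull_radius, shrink. now rewrite circ_2PI. }
    assert (EQ : CInt (pull_angle F r w 1) 0 (2 * PI) = I1).
    { apply CInt_ext; [lra|]. intros; unfold pull_angle, shrink. f_equal. f_equal. ring. }
    rewrite EP EQ in G. rewrite -(Cplus_0_r (CInt (pull_angle F r w t) 0 (2 * PI))) -G;
      [ring|lra]. }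
  assert (Hsmall : forall eps, 0 < eps -> Cmod (I1 - I2) <= eps).
  { intros eps He.
    set (K0 := 4 * PI * (r / (r - Cmod w))).
    assert (K1 : 0 < r / (r - Cmod w)) by (apply Rdiv_lt_0_compat; lra).
    assert (HK0 : 0 < K0) by (unfold K0; apply Rmult_lt_0_compat; lra).
    destruct (cdiff_continuous F w (HF w ltac:(lra)) (eps / K0)) as [d [Hd H]];
      [now apply Rdiv_lt_0_compat|].
    set (t := Rmin 1 (d / (4 * r))).
    assert (Ht : 0 < t <= 1).
    { split; [apply Rmin_glb_lt; [lra|apply Rdiv_lt_0_compat; lra]|apply Rmin_l]. }
    assert (Ht2 : t <= d / (4 * r)) by apply Rmin_r.
    rewrite -(Hconst t Ht). unfold I2. rewrite -CInt_minus; [|lra| |].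
    2: { intros x _; eapply ccont_pull_angle; eauto; lra. }
    2: { intros x _. apply ccont_mult; [apply ccont_const|now apply ccont_kernel]. }
    replace eps with (2 * (eps / K0 * (r / (r - Cmod w))) * (2 * PI - 0)).
    2: { unfold K0. field. repeat split; lra. }
    apply CInt_bound; [lra| |].
    - intros x _. apply ccont_minus; [eapply ccont_pull_angle; eauto; lra|].
      apply ccont_mult; [apply ccont_const|now apply ccont_kernel].
    - intros x _. unfold pull_angle.
      replace (F (shrink r w t x) * kernel r w x - F w * kernel r w x)%C
        with ((F (shrink r w t x) - F w) * kernel r w x)%C by ring.
      rewrite Cmod_mult. apply Rmult_le_compat; try apply Cmod_ge_0; [|now apply kernel_bound].
      apply Rlt_le, H. unfold shrink.
      replace (w + t * (circ r x - w) - w)%C with (t * (circ r x - w))%C by ring.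
      rewrite Cmod_mult Cmod_R Rabs_pos_eq; [|lra].
      assert (A1 : Cmod (circ r x - w) <= 2 * r).
      { eapply Rle_trans; [apply Cmod_minus_le|]. rewrite Cmod_circ; lra. }
      apply Rle_lt_trans with (d / (4 * r) * (2 * r)).
      + apply Rmult_le_compat; try apply Cmod_ge_0; lra.
      + replace (d / (4 * r) * (2 * r)) with (d / 2) by (field; lra). lra. }
  assert (E : (I1 - I2)%C = RtoC 0).
  { apply Cmod_eq_0. apply Rle_antisym; [|apply Cmod_ge_0].
    apply Rnot_lt_le; intros N. specialize (Hsmall (Cmod (I1 - I2) / 2)). lra. }
  rewrite -(Cplus_0_l I2) -E. ring.
Qed.

(** * Power series expansion *)

Lemma circ_neq r th : 0 < r -> circ r th <> RtoC 0.
Proof. intros Hr E. assert (H := Cmod_circ r th). rewrite E Cmod_0 in H. lra. Qed.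

Lemma circ_inv_pow r k th : 0 < r ->
  ((/ circ r th) ^ k)%C = ((/ r) ^ k * cos (INR k * th), - ((/ r) ^ k * sin (INR k * th))).
Proof.
  intros Hr. induction k as [|k IH].
  - simpl. rewrite Rmult_0_l cos_0 sin_0. apply C_ext; simpl; ring.
  - rewrite Cpow_S IH S_INR Rmult_plus_distr_r Rmult_1_l cos_plus sin_plus.
    assert (E : (/ circ r th)%C = (/ r * cos th, - (/ r * sin th))).
    { assert (S := sin2_cos2 th). unfold Rsqr in S.
      unfold Cinv, circ; simpl fst; simpl snd.
      assert (D : (r * cos th) ^ 2 + (r * sin th) ^ 2 = r ^ 2) by nra.
      rewrite D. apply C_ext; simpl; field; lra. }
    rewrite E. apply C_ext; simpl; ring.
Qed.

Lemma CInt_circ_inv_pow r k : 0 < r -> k <> O ->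
  CInt (fun th => (/ circ r th) ^ k)%C 0 (2 * PI) = RtoC 0.
Proof.
  intros Hr Hk. assert (HPI := PI_RGT_0). assert (Hn : INR k <> 0) by now apply not_0_INR.
  rewrite (CInt_derive (fun th =>
    ((/ r) ^ k * sin (INR k * th) / INR k, (/ r) ^ k * cos (INR k * th) / INR k))); try lra.
  - replace (INR k * (2 * PI)) with (0 + 2 * INR k * PI) by ring.
    rewrite sin_period cos_period Rmult_0_r. ring.
  - intros x _. rewrite circ_inv_pow; auto. split; simpl; auto_derive; auto; field; lra.
  - intros x _. apply ccont_pow, ccont_inv; [apply ccont_circ|now apply circ_neq].
Qed.

(** One step of the geometric expansion of the Cauchy kernel in powers of
    [w / z]. *)
Lemma kernel_step r w th : Cmod w < r ->
  kernel r w th = (Ci + w * / circ r th * kernel r w th)%C.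
Proof.
  intros Hw. assert (H0 := Cmod_ge_0 w).
  assert (E : dcirc r th = (Ci * circ r th)%C) by (apply C_ext; simpl; ring).
  unfold kernel. rewrite E. field. split; [now apply circ_minus_neq|apply circ_neq; lra].
Qed.

(** Up to the factor [2 pi], the [k]-th Taylor coefficient of a holomorphic
    function whose values on the circle are [f]. *)
Definition moment (f : R -> C) r k : C :=
  CInt (fun th => f th * (/ circ r th) ^ k)%C 0 (2 * PI).

(** The remainder after [k] steps of the geometric expansion, without the factor
    [w ^ k]; for [k = 0] it is the Cauchy integral of [f]. *)
Definition kernel_moment (f : R -> C) r w k : C :=
  CInt (fun th => f th * (/ circ r th) ^ k * kernel r w th)%C 0 (2 * PI).

Lemma ccont_moment f r k th : 0 < r -> ccont f th ->
  ccont (fun th => f th * (/ circ r th) ^ k)%C th.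
Proof.
  intros Hr Hf. apply ccont_mult; auto.
  apply ccont_pow, ccont_inv; [apply ccont_circ|now apply circ_neq].
Qed.

Lemma kernel_moment_step f r w k : (forall th, ccont f th) -> Cmod w < r ->
  kernel_moment f r w k = (Ci * moment f r k + w * kernel_moment f r w (S k))%C.
Proof.
  intros Hf Hw. assert (HPI := PI_RGT_0). assert (H0 := Cmod_ge_0 w).
  unfold kernel_moment, moment. rewrite -CInt_scal; try lra.
  2: { intros th _. apply ccont_moment; auto; lra. }
  rewrite -CInt_scal; try lra.
  2: { intros th _. apply ccont_mult; [apply ccont_moment; auto; lra|now apply ccont_kernel]. }
  rewrite -CInt_plus; try lra.
  - apply CInt_ext; [lra|]. intros th _. rewrite {1}(kernel_step r w th Hw) Cpow_S. ring.
  - intros th _. apply ccont_mult; [apply ccont_const|apply ccont_moment; auto; lra].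
  - intros th _. apply ccont_mult; [apply ccont_const|].
    apply ccont_mult; [apply ccont_moment; auto; lra|now apply ccont_kernel].
Qed.

Lemma moment_bound f r k M : (forall th, ccont f th) -> 0 < r ->
  (forall th, 0 <= th <= 2 * PI -> Cmod (f th) <= M) ->
  Cmod (moment f r k) <= 2 * (M * (/ r) ^ k) * (2 * PI).
Proof.
  intros Hf Hr HM. assert (HPI := PI_RGT_0). rewrite -{1}(Rminus_0_r (2 * PI)).
  apply CInt_bound; [lra| |].
  - intros th _. now apply ccont_moment.
  - intros th Hth. rewrite Cmod_mult Cmod_pow Cmod_inv; [|now apply circ_neq].
    rewrite Cmod_circ; [|lra].
    apply Rmult_le_compat_r; auto. apply pow_le, Rlt_le, Rinv_0_lt_compat; auto.
Qed.

Lemma kernel_moment_bound f r w k M : (forall th, ccont f th) -> Cmod w < r ->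
  (forall th, 0 <= th <= 2 * PI -> Cmod (f th) <= M) ->
  Cmod (kernel_moment f r w k) <= 2 * (M * (/ r) ^ k * (r / (r - Cmod w))) * (2 * PI).
Proof.
  intros Hf Hw HM. assert (HPI := PI_RGT_0). assert (H0 := Cmod_ge_0 w).
  rewrite -{1}(Rminus_0_r (2 * PI)).
  assert (Hr : 0 < r) by lra.
  apply CInt_bound; [lra| |].
  - intros th _. apply ccont_mult; [now apply ccont_moment|now apply ccont_kernel].
  - intros th Hth. rewrite Cmod_mult.
    apply Rmult_le_compat; try apply Cmod_ge_0; [|now apply kernel_bound].
    rewrite Cmod_mult Cmod_pow Cmod_inv; [|now apply circ_neq]. rewrite Cmod_circ; [|lra].
    apply Rmult_le_compat_r; auto. apply pow_le, Rlt_le, Rinv_0_lt_compat; auto.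
Qed.

(** The values are typed in [C] itself rather than in the carrier of its abelian
    monoid structure, so that field identities apply to them. *)
Definition Csum (u : nat -> C) (n : nat) : C := sum_n (G := C_AbelianMonoid) u n.

Lemma Csum_O u : Csum u O = u O.
Proof. exact (sum_O (G := C_AbelianMonoid) u). Qed.

Lemma Csum_S u n : Csum u (S n) = (Csum u n + u (S n))%C.
Proof. exact (sum_Sn (G := C_AbelianMonoid) u n). Qed.

Lemma pow_n_Cpow (z : C) k : pow_n (K := C_AbsRing) z k = (z ^ k)%C.
Proof. induction k as [|k IH]; [reflexivity|]. rewrite Cpow_S -IH. reflexivity. Qed.

Lemma is_series_C_intro (u : nat -> C) (l : C) :
  (forall eps, 0 < eps -> exists N, forall n, (N <= n)%nat ->
     Cmod (Csum u n - l)%C < eps) ->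
  is_series (K := C_AbsRing) (V := C_NormedModule) u l.
Proof.
  intros H. apply filterlim_locally. intros eps. destruct (H eps (cond_pos eps)) as [N HN].
  exists N. intros n Hn. specialize (HN n Hn). split; (eapply Rle_lt_trans; [|apply HN]).
  - apply (fst_le_Cmod (Csum u n - l)%C).
  - apply (snd_le_Cmod (Csum u n - l)%C).
Qed.

Lemma is_series_C_elim (u : nat -> C) (l : C) :
  is_series (K := C_AbsRing) (V := C_NormedModule) u l ->
  forall eps, 0 < eps -> exists N, forall n, (N <= n)%nat ->
     Cmod (Csum u n - l)%C < eps.
Proof.
  intros H eps He. assert (He2 : 0 < eps / 2) by lra.
  destruct (proj1 (filterlim_locally _ _) H (mkposreal _ He2)) as [N HN].
  exists N. intros n Hn. destruct (HN n Hn) as [H1 H2].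
  eapply Rle_lt_trans; [apply Cmod_le_abs_sum|].
  change (Rabs (fst (Csum u n) - fst l) < eps / 2) in H1.
  change (Rabs (snd (Csum u n) - snd l) < eps / 2) in H2.
  simpl. apply Rle_lt_trans with
    (Rabs (fst (Csum u n) - fst l) + Rabs (snd (Csum u n) - snd l));
    [right; reflexivity|lra].
Qed.

Lemma kernel_moment_sum f r w N : (forall th, ccont f th) -> Cmod w < r ->
  kernel_moment f r w 0 = (Ci * Csum (fun k => w ^ k * moment f r k)%C N
                  + w ^ S N * kernel_moment f r w (S N))%C.
Proof.
  intros Hf Hw. induction N as [|N IH].
  - rewrite Csum_O kernel_moment_step; auto. simpl. ring.
  - rewrite Csum_S IH (kernel_moment_step f r w (S N)) // !Cpow_S. ring.
Qed.

(** All moments of a constant except the first vanish, so the expansion is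
    the single term on the right plus a remainder that tends to 0.  This
    evaluates the integral of the Cauchy kernel for every [w] in the disk. *)
Lemma kernel_moment_const c r w : Cmod w < r ->
  kernel_moment (fun _ => c) r w 0 = (Ci * (RtoC (2 * PI) * c))%C.
Proof.
  intros Hw. assert (HPI := PI_RGT_0). assert (H0 := Cmod_ge_0 w).
  assert (Hc : forall th, ccont (fun _ => c) th) by (intros; apply ccont_const).
  assert (M0 : moment (fun _ => c) r 0 = (RtoC (2 * PI) * c)%C).
  { unfold moment. rewrite (CInt_ext _ (fun _ => c)); [|lra|intros; simpl; ring].
    rewrite CInt_const; [|lra]. now rewrite Rminus_0_r. }
  assert (MS : forall k, moment (fun _ => c) r (S k) = RtoC 0).
  { intros k. unfold moment. rewrite CInt_scal; [|lra|].
    - rewrite CInt_circ_inv_pow; [ring|lra|lia].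
    - intros th _. apply ccont_pow, ccont_inv; [apply ccont_circ|apply circ_neq; lra]. }
  assert (Hsum : forall N,
    Csum (fun k => w ^ k * moment (fun _ => c) r k)%C N = (RtoC (2 * PI) * c)%C).
  { induction N as [|N IH]; [rewrite Csum_O M0; simpl; ring|].
    rewrite Csum_S IH MS. ring. }
  assert (Hrem : forall N,
    (kernel_moment (fun _ => c) r w 0 - Ci * (RtoC (2 * PI) * c))%C
    = (w ^ S N * kernel_moment (fun _ => c) r w (S N))%C).
  { intros N. rewrite (kernel_moment_sum _ r w N) // Hsum. ring. }
  set (X := (kernel_moment (fun _ => c) r w 0 - Ci * (RtoC (2 * PI) * c))%C) in *.
  assert (X0 : X = RtoC 0).
  { apply Cmod_eq_0. apply Rle_antisym; [|apply Cmod_ge_0]. apply Rnot_lt_le; intros NX.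
    set (K0 := 2 * (Cmod c * (r / (r - Cmod w))) * (2 * PI)).
    assert (K1 : 0 < r / (r - Cmod w)) by (apply Rdiv_lt_0_compat; lra).
    assert (K2 : 0 <= K0).
    { unfold K0. repeat first [apply Cmod_ge_0 | lra | apply Rmult_le_pos]. }
    destruct (geometric_small K0 (Cmod w) r (Cmod X)) as [N HN]; try lra.
    specialize (HN (S N) ltac:(lia)).
    assert (B : Cmod X <= K0 * (Cmod w / r) ^ S N).
    { rewrite {1}(Hrem N) Cmod_mult Cmod_pow.
      assert (B := kernel_moment_bound (fun _ => c) r w (S N) (Cmod c)
        Hc Hw (fun _ _ => Rle_refl _)).
      unfold Rdiv at 1. rewrite Rpow_mult_distr.
      apply Rle_trans with
        (Cmod w ^ S N * (2 * (Cmod c * (/ r) ^ S N * (r / (r - Cmod w))) * (2 * PI))).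
      - apply Rmult_le_compat_l; auto. apply pow_le; auto.
      - right; unfold K0; ring. }
    lra. }
  unfold X in X0. replace (kernel_moment (fun _ : R => c) r w 0) with
    ((kernel_moment (fun _ : R => c) r w 0 - Ci * (RtoC (2 * PI) * c))
     + Ci * (RtoC (2 * PI) * c))%C by ring.
  rewrite X0. ring.
Qed.

(** Cauchy's formula identifies the Cauchy integrals of [F] on the circle and of
    the constant [F w]; the second one is known, and the geometric expansion
    of the first one is the Taylor series. *)
Lemma cauchy_power_series F r R0 M : cdiff_disc F R0 -> 0 < r < R0 ->
  (forall th, 0 <= th <= 2 * PI -> Cmod (F (circ r th)) <= M) ->
  exists c : nat -> C, (forall k, Cmod (c k) <= 2 * M * (/ r) ^ k) /\
    forall w, Cmod w < r -> is_pseries (K := C_AbsRing) (V := C_NormedModule) c w (F w).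
Proof.
  intros HF Hr HM. assert (HPI := PI_RGT_0).
  set (f := fun th => F (circ r th)).
  assert (Hf : forall th, ccont f th).
  { intros th. apply ccont_cdiff; [apply HF; rewrite Cmod_circ; lra|apply ccont_circ]. }
  assert (M0 : 0 <= M) by (eapply Rle_trans; [apply Cmod_ge_0|apply (HM 0); lra]).
  exists (fun k => (/ RtoC (2 * PI) * moment f r k)%C).
  assert (HP : RtoC (2 * PI) <> RtoC 0) by (intros E; apply RtoC_inj in E; lra).
  split.
  - intros k. rewrite Cmod_mult Cmod_inv // Cmod_R Rabs_pos_eq; [|lra].
    assert (B := moment_bound f r k M Hf (proj1 Hr) HM).
    apply Rmult_le_reg_l with (2 * PI); [lra|].
    rewrite -Rmult_assoc Rinv_r ?Rmult_1_l; lra.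
  - intros w Hw. assert (H0 := Cmod_ge_0 w).
    assert (HC : kernel_moment f r w 0 = (Ci * (RtoC (2 * PI) * F w))%C).
    { rewrite -(kernel_moment_const (F w) r w Hw). unfold kernel_moment.
      rewrite (CInt_ext _ (fun th => f th * kernel r w th)%C); [|lra|intros; simpl; ring].
      rewrite (CInt_ext (fun th => F w * _ * _)%C (fun th => F w * kernel r w th)%C);
        [|lra|intros; simpl; ring].
      apply (cauchy_formula F r w R0); auto; lra. }
    unfold is_pseries. apply is_series_C_intro. intros eps He.
    set (K0 := 2 * (M * (r / (r - Cmod w)))).
    assert (K1 : 0 < r / (r - Cmod w)) by (apply Rdiv_lt_0_compat; lra).
    assert (K2 : 0 <= K0).
    { unfold K0. repeat first [lra | apply Rmult_le_pos]. }
    destruct (geometric_small K0 (Cmod w) r eps) as [N HN]; try lra.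
    exists N. intros n Hn. specialize (HN (S n) ltac:(lia)).
    assert (ES : Csum (fun k =>
         scal (pow_n (K := C_AbsRing) w k) (/ RtoC (2 * PI) * moment f r k : C)%C) n
       = (/ RtoC (2 * PI) * Csum (fun k => w ^ k * moment f r k) n)%C).
    { clear -HP. induction n as [|n IH].
      - rewrite !Csum_O pow_n_Cpow. change scal with Cmult. ring.
      - rewrite !Csum_S IH pow_n_Cpow. change scal with Cmult. ring. }
    assert (HK := kernel_moment_sum f r w n Hf Hw). rewrite HC in HK.
    change (Cmod (Csum (fun k =>
      scal (pow_n (K := C_AbsRing) w k) (/ RtoC (2 * PI) * moment f r k : C)%C) n - F w)%C < eps).
    rewrite ES.
    set (Sg := Csum (fun k => w ^ k * moment f r k)%C n).
    change (Csum (fun k => w ^ k * moment f r k)%C n) with Sg in HK.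
    assert (Ei : (Ci * Ci)%C = RtoC (-1)) by (apply C_ext; simpl; ring).
    assert (E : (/ RtoC (2 * PI) * Sg - F w)%C
      = (/ RtoC (2 * PI) * (Ci * (w ^ S n * kernel_moment f r w (S n))))%C).
    { replace (w ^ S n * kernel_moment f r w (S n))%C
        with (Ci * (RtoC (2 * PI) * F w) - Ci * Sg)%C by (rewrite HK; ring).
      replace (Ci * (Ci * (RtoC (2 * PI) * F w) - Ci * Sg))%C
        with ((Ci * Ci) * (RtoC (2 * PI) * F w - Sg))%C by ring.
      rewrite Ei. field; auto. }
    rewrite E !Cmod_mult Cmod_pow Cmod_inv // Cmod_R Rabs_pos_eq; [|lra].
    assert (ECi : Cmod Ci = 1).
    { unfold Cmod, Ci; simpl fst; simpl snd. replace (0 ^ 2 + 1 ^ 2) with 1 by ring.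
      apply sqrt_1. }
    rewrite ECi.
    assert (B := kernel_moment_bound f r w (S n) M Hf Hw HM).
    apply Rle_lt_trans with (/ (2 * PI) * (1 * (Cmod w ^ S n *
      (2 * (M * (/ r) ^ S n * (r / (r - Cmod w))) * (2 * PI))))).
    { apply Rmult_le_compat_l; [apply Rlt_le, Rinv_0_lt_compat; lra|].
      apply Rmult_le_compat_l; [lra|]. apply Rmult_le_compat_l; auto. apply pow_le; auto. }
    replace (/ (2 * PI) * (1 * (Cmod w ^ S n *
      (2 * (M * (/ r) ^ S n * (r / (r - Cmod w))) * (2 * PI)))))
      with (K0 * (Cmod w / r) ^ S n).
    2: { unfold Rdiv at 1. rewrite Rpow_mult_distr. unfold K0. field. repeat split; lra. }
    exact HN.
Qed.

(** * Leading terms and the identity theorem *)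

Lemma circle_bound F r R0 : cdiff_disc F R0 -> 0 < r < R0 ->
  exists M, forall th, 0 <= th <= 2 * PI -> Cmod (F (circ r th)) <= M.
Proof.
  intros HF Hr. assert (HPI := PI_RGT_0).
  destruct (continuity_ab_maj (fun th => Cmod (F (circ r th))) 0 (2 * PI)) as [x [Hx _]].
  - lra.
  - intros x _.
    assert (Hc : ccont (fun th => F (circ r th)) x).
    { apply ccont_cdiff; [apply HF; rewrite Cmod_circ; lra|apply ccont_circ]. }
    intros eps He. destruct (ccont_eps _ _ Hc eps He) as [d [Hd H]].
    exists d. split; auto. intros y [_ Hy]. specialize (H y Hy). simpl. unfold Rdist.
    assert (A1 := Cmod_minus_ge (F (circ r y)) (F (circ r x))).
    assert (A2 := Cmod_minus_ge (F (circ r x)) (F (circ r y))).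
    rewrite (Cmod_minus_sym (F (circ r x))) in A2.
    apply Rabs_def1; lra.
  - exists (Cmod (F (circ r x))). exact Hx.
Qed.

Lemma partial_sum_leading_term (u : nat -> C) m A q : (forall k, (k < m)%nat -> u k = RtoC 0) ->
  0 <= A -> 0 <= q <= / 2 -> (forall k, Cmod (u k) <= A * q ^ k) ->
  forall j, Cmod (Csum u (m + j) - u m) <= 2 * A * q ^ S m * (1 - (/ 2) ^ j).
Proof.
  intros H0 HA Hq Hu.
  assert (Hz : forall k, (k < m)%nat -> Csum u k = RtoC 0).
  { induction k as [|k IH]; intros Hk; [rewrite Csum_O; auto|].
    rewrite Csum_S IH; [|lia]. rewrite H0; auto. ring. }
  assert (Hm : Csum u m = u m).
  { destruct m as [|m]; [apply Csum_O|]. rewrite Csum_S Hz; [|lia]. ring. }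
  induction j as [|j IH].
  - rewrite Nat.add_0_r Hm. replace (u m - u m)%C with (RtoC 0) by ring. rewrite Cmod_0. simpl.
    lra.
  - rewrite Nat.add_succ_r Csum_S.
    replace (Csum u (m + j) + u (S (m + j)) - u m)%C
      with ((Csum u (m + j) - u m) + u (S (m + j)))%C by ring.
    eapply Rle_trans; [apply Cmod_triangle|].
    assert (B : Cmod (u (S (m + j))) <= A * q ^ S m * (/ 2) ^ j).
    { eapply Rle_trans; [apply Hu|]. replace (S (m + j)) with (S m + j)%nat by lia.
      rewrite pow_add -Rmult_assoc. apply Rmult_le_compat_l.
      - apply Rmult_le_pos; auto. apply pow_le; lra.
      - apply pow_incr; lra. }
    simpl ((/ 2) ^ S j). lra.
Qed.

Lemma Csum_pseries c w n :
  sum_n (G := C_AbelianMonoid) (fun k => scal (pow_n (K := C_AbsRing) w k) (c k : C)) n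
  = Csum (fun k => w ^ k * c k)%C n.
Proof. apply sum_n_ext. intros k. now rewrite pow_n_Cpow. Qed.

Lemma pseries_limit (c : nat -> C) w l :
  is_pseries (K := C_AbsRing) (V := C_NormedModule) c w l ->
  forall eps, 0 < eps -> exists N, forall n, (N <= n)%nat ->
    Cmod (Csum (fun k => w ^ k * c k)%C n - l) < eps.
Proof.
  intros H eps He. destruct (is_series_C_elim _ _ H eps He) as [N HN]. exists N. intros n Hn.
  specialize (HN n Hn). rewrite -Csum_pseries. exact HN.
Qed.

(** The first nonzero Taylor coefficient gives the leading term; on half the
    radius the remaining terms are dominated by a geometric series of ratio
    at most 1/2. *)
Lemma leading_term F r R0 : cdiff_disc F R0 -> 0 < r < R0 ->
  (forall w, Cmod w < r -> F w = RtoC 0) \/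
  exists m b M, b <> RtoC 0 /\ 0 <= M /\
    forall u, Cmod u <= r / 2 -> Cmod (F u - b * u ^ m) <= M * Cmod u ^ S m.
Proof.
  intros HF Hr. destruct (circle_bound F r R0 HF Hr) as [M HM].
  destruct (cauchy_power_series F r R0 M HF Hr HM) as [c [Hc Hs]].
  assert (M0 : 0 <= M).
  { assert (HPI := PI_RGT_0). eapply Rle_trans; [apply Cmod_ge_0|apply (HM 0); lra]. }
  destruct (classic (forall k, c k = RtoC 0)) as [Z|NZ].
  - left. intros w Hw. apply Cmod_eq_0. apply Rle_antisym; [|apply Cmod_ge_0].
    apply Rnot_lt_le. intros N.
    destruct (pseries_limit _ _ _ (Hs w Hw) _ N) as [n Hn].
    specialize (Hn n (le_n _)).
    assert (E : Csum (fun k => w ^ k * c k)%C n = RtoC 0).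
    { clear Hn. induction n as [|n IH]; [rewrite Csum_O Z; ring|]. rewrite Csum_S IH Z. ring. }
    rewrite E in Hn. replace (0 - F w)%C with (- F w)%C in Hn by ring. rewrite Cmod_opp in Hn.
    lra.
  - right.
    assert (Hmin : exists m, c m <> RtoC 0 /\ forall k, (k < m)%nat -> c k = RtoC 0).
    { apply not_all_ex_not in NZ. destruct NZ as [n Hn]. revert Hn.
      induction n as [n IH] using (well_founded_induction Nat.lt_wf_0). intros Hn.
      destruct (classic (exists k, (k < n)%nat /\ c k <> RtoC 0)) as [(k & Hk & Hck)|No].
      - exact (IH k Hk Hck).
      - exists n. split; auto. intros k Hk. apply NNPP. intros Hck. apply No. now exists k. }
    destruct Hmin as [m [Hm Hk]].
    exists m, (c m), (4 * M * (/ r) ^ S m). split; auto.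
    assert (Hri : 0 < / r) by (apply Rinv_0_lt_compat; lra).
    split. { apply Rmult_le_pos; [lra|]. apply pow_le; lra. }
    intros u Hu. assert (Hu0 := Cmod_ge_0 u).
    apply le_epsilon. intros eps He.
    destruct (pseries_limit _ _ _ (Hs u ltac:(lra)) eps He) as [N HN].
    specialize (HN (m + N)%nat ltac:(lia)).
    assert (Hq : 0 <= Cmod u * / r <= / 2).
    { split; [apply Rmult_le_pos; lra|]. apply Rmult_le_reg_r with r; [lra|].
      rewrite Rmult_assoc Rinv_l; lra. }
    assert (T := partial_sum_leading_term (fun k => u ^ k * c k)%C m (2 * M) (Cmod u * / r)).
    specialize (T ltac:(intros k Hkm; simpl; rewrite Hk; auto; ring) ltac:(lra) Hq).
    assert (Hb : forall k, Cmod (u ^ k * c k) <= 2 * M * (Cmod u * / r) ^ k).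
    { intros k. rewrite Cmod_mult Cmod_pow Rpow_mult_distr.
      apply Rle_trans with (Cmod u ^ k * (2 * M * (/ r) ^ k)).
      - apply Rmult_le_compat_l; auto. apply pow_le; auto.
      - right; ring. }
    specialize (T Hb N).
    replace (F u - c m * u ^ m)%C
      with ((Csum (fun k => u ^ k * c k)%C (m + N) - u ^ m * c m) -
      (Csum (fun k => u ^ k * c k)%C (m + N) - F u))%C by ring.
    eapply Rle_trans; [apply Cmod_minus_le|].
    assert (P : 0 <= 4 * M * (Cmod u * / r) ^ S m).
    { apply Rmult_le_pos; [lra|]. apply pow_le; lra. }
    assert (P2 : 0 <= (/2) ^ N) by (apply pow_le; lra).
    rewrite Rpow_mult_distr in P, T.
    apply Rplus_le_compat; [|lra]. eapply Rle_trans; [apply T|].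
    nra.
Qed.

(** A nonzero leading term [b u ^ m] cannot be [O(u ^ (m + 1))] at 0. *)
Lemma vanish_near_center F d R0 : cdiff_disc F R0 -> 0 < d ->
  (forall w, Cmod w < d -> F w = RtoC 0) ->
  forall w, Cmod w < R0 -> F w = RtoC 0.
Proof.
  intros HF Hd H0 w Hw. assert (Hw0 := Cmod_ge_0 w).
  destruct (leading_term F ((Cmod w + R0) / 2) R0 HF) as [Z|(m & b & M & Hb & HM & H)];
    [lra|apply Z; lra|].
  exfalso. set (r := (Cmod w + R0) / 2) in *.
  assert (Hbp : 0 < Cmod b) by (apply Cmod_gt_0; auto).
  (* A point so close to 0 that M x < |b|, which the leading term forbids. *)
  set (x := Rmin (r / 2) (Rmin (d / 2) (Cmod b / (2 * (M + 1))))).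
  assert (X0 : 0 < x).
  { repeat apply Rmin_glb_lt; [unfold r; lra|lra|apply Rdiv_lt_0_compat; lra]. }
  assert (X1 : x <= r / 2) by apply Rmin_l.
  assert (X2 : x <= Rmin (d / 2) (Cmod b / (2 * (M + 1)))) by apply Rmin_r.
  assert (X3 := Rmin_l (d / 2) (Cmod b / (2 * (M + 1)))).
  assert (X4 := Rmin_r (d / 2) (Cmod b / (2 * (M + 1)))).
  assert (EC : Cmod x = x) by (rewrite Cmod_R; apply Rabs_pos_eq; lra).
  specialize (H (RtoC x)). rewrite EC H0 in H; [|rewrite EC; lra].
  specialize (H X1). replace (0 - b * x ^ m)%C with (- (b * x ^ m))%C in H by ring.
  rewrite Cmod_opp Cmod_mult Cmod_pow EC in H. simpl in H.
  assert (Hp : 0 < x ^ m) by (apply pow_lt; auto).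
  assert (H' : Cmod b <= M * x) by (apply Rmult_le_reg_r with (x ^ m); auto; nra).
  assert (H'' : (M + 1) * x <= (M + 1) * (Cmod b / (2 * (M + 1))))
    by (apply Rmult_le_compat_l; lra).
  replace ((M + 1) * (Cmod b / (2 * (M + 1)))) with (Cmod b / 2) in H'' by (field; lra).
  nra.
Qed.

(** Let [G n w = F (1 - q + q w)] with [q = (3/4) ^ n].  For large [n] the
    argument stays near 1, so [G n = 0].  If [G (S n) = 0], then [G n] vanishes
    on the image of the disk under [w |-> 1/4 + 3/4 w], which is a neighborhood
    of 0, because 3/4 > 1/2; hence [G n = 0] by [vanish_near_center].
    Descending to [n = 0] gives [F = 0]. *)
Lemma vanish_near_one F d : cdiff_disc F 1 -> 0 < d ->
  (forall w, Cmod w < 1 -> Cmod (1 - w) < d -> F w = RtoC 0) ->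
  forall w, Cmod w < 1 -> F w = RtoC 0.
Proof.
  intros HF Hd H0.
  assert (Hq : forall n, 0 < (3 / 4) ^ n <= 1).
  { intros n. split; [apply pow_lt; lra|]. rewrite -(pow1 n). apply pow_incr; lra. }
  assert (Hin : forall q w, 0 < q <= 1 -> Cmod w < 1 -> Cmod (RtoC (1 - q) + q * w) < 1).
  { intros q w Hq' Hw. eapply Rle_lt_trans; [apply Cmod_triangle|].
    rewrite Cmod_mult !Cmod_R !Rabs_pos_eq; try lra. nra. }
  set (G := fun n w => F (RtoC (1 - (3 / 4) ^ n) + RtoC ((3 / 4) ^ n) * w)%C).
  assert (HG : forall n, cdiff_disc (G n) 1).
  { intros n w Hw. apply (cdiff_affine_comp F). apply HF, Hin; auto. }
  assert (Hdown : forall n, (forall w, Cmod w < 1 -> G (S n) w = RtoC 0) ->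
    forall w, Cmod w < 1 -> G n w = RtoC 0).
  { intros n Hn. apply (vanish_near_center (G n) (/ 2)); auto; [lra|].
    (* The preimage of w under w |-> 1/4 + 3/4 w. *)
    intros w Hw. rewrite -(Hn (RtoC (4 / 3) * w - RtoC (1 / 3))%C).
    - unfold G. f_equal. apply C_ext; simpl; field.
    - eapply Rle_lt_trans; [apply Cmod_minus_le|]. rewrite Cmod_mult !Cmod_R !Rabs_pos_eq; lra. }
  destruct (geometric_small 2 3 4 d) as [N HN]; try lra. specialize (HN N (le_n _)).
  assert (HGN : forall w, Cmod w < 1 -> G N w = RtoC 0).
  { intros w Hw. apply H0; [now apply Hin|].
    replace (1 - (RtoC (1 - (3 / 4) ^ N) + RtoC ((3 / 4) ^ N) * w))%C
      with (RtoC ((3/4) ^ N) * (1 - w))%C by (rewrite RtoC_minus; ring).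
    rewrite Cmod_mult Cmod_R Rabs_pos_eq; [|apply Rlt_le, Hq].
    assert (A := Cmod_minus_le 1 w). rewrite Cmod_1 in A. specialize (Hq N). nra. }
  assert (HG0 : forall w, Cmod w < 1 -> G O w = RtoC 0).
  { clear HN. induction N as [|N IH]; auto. }
  intros w Hw. rewrite -(HG0 w Hw). unfold G. f_equal. apply C_ext; simpl; ring.
Qed.

(** * Estimates of the Hardy norm *)

Lemma is_taylor_of_pseries (E : C -> C) c r : 1 <= r ->
  (forall w, Cmod w < r -> is_pseries (K := C_AbsRing) (V := C_NormedModule) c w (E w)) ->
  is_taylor (fun z : disk => E z) c.
Proof. intros Hr H [z Hz]. apply H. simpl. lra. Qed.

(** A bound on a circle of radius 2 makes the Taylor coefficients decay like
    [2 ^ - k], so their square sum is controlled by the sup norm. *)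
Lemma H2norm_le_of_bounded E M : cdiff_disc E 3 -> (forall z, Cmod z <= 2 -> Cmod (E z) <= M) ->
  exists r, is_H2norm (fun z : disk => E z) r /\ r <= 4 * M.
Proof.
  intros HE HM.
  assert (M0 : 0 <= M) by (eapply Rle_trans; [apply Cmod_ge_0|
    apply (HM (RtoC 0)); rewrite Cmod_0; lra]).
  destruct (cauchy_power_series E 2 3 M HE) as [c [Hc Hs]]; [lra| |].
  { intros th _. apply HM. rewrite Cmod_circ; lra. }
  assert (Hb : forall n, 0 <= Cmod (c n) ^ 2 <= 4 * M ^ 2 * (/ 4) ^ n).
  { intros n. split; [apply pow2_ge_0|].
    replace (4 * M ^ 2 * (/ 4) ^ n) with ((2 * M * (/ 2) ^ n) ^ 2).
    - apply pow_incr. split; [apply Cmod_ge_0|auto].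
    - rewrite Rpow_mult_distr -pow_mult Nat.mul_comm pow_mult.
      replace ((/ 2) ^ 2) with (/ 4) by field. ring. }
  assert (Hg : ex_series (fun n => 4 * M ^ 2 * (/ 4) ^ n)).
  { apply (ex_series_scal_l (4 * M ^ 2) (fun n => (/ 4) ^ n)). apply ex_series_geom.
    rewrite Rabs_pos_eq; lra. }
  assert (Hex : ex_series (fun n => Cmod (c n) ^ 2)).
  { apply (ex_series_le (K := R_AbsRing) (V := R_CompleteNormedModule) _
      (fun n => 4 * M ^ 2 * (/ 4) ^ n)); auto.
    intros n. change (Rabs (Cmod (c n) ^ 2) <= 4 * M ^ 2 * (/ 4) ^ n).
    rewrite Rabs_pos_eq; apply Hb. }
  set (S := Series (fun n => Cmod (c n) ^ 2)).
  assert (S1 : S <= 4 * M ^ 2 * (/ (1 - / 4))).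
  { rewrite -Series_geom; [|rewrite Rabs_pos_eq; lra]. rewrite -Series_scal_l.
    apply Series_le; auto. }
  assert (S0 : 0 <= S).
  { assert (Z : Series (fun n => 0 * 0) = 0) by (rewrite Series_scal_l; ring).
    rewrite -Z. apply Series_le; auto. intros n. split; [lra|]. destruct (Hb n). lra. }
  exists (sqrt S). split.
  - split; [apply sqrt_pos|]. exists c. split.
    + apply (is_taylor_of_pseries E c 2); [lra|auto].
    + rewrite pow2_sqrt; auto. apply Series_correct; auto.
  - apply Rsqr_incr_0; [|apply sqrt_pos|lra]. rewrite Rsqr_sqrt; auto. unfold Rsqr. nra.
Qed.

(** Each Taylor coefficient is at most the norm, and a geometric series
    bounds the value. *)
Lemma H2norm_eval f r (z : disk) : is_H2norm f r -> Cmod (f z) <= r / (1 - Cmod z).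
Proof.
  intros [Hr [c [Ht Hs]]].
  assert (Hz : 0 <= Cmod z < 1) by (split; [apply Cmod_ge_0|apply (proj2_sig z)]).
  assert (Hc : forall n, Cmod (c n) <= r).
  { assert (Hp : forall n, 0 <= Cmod (c n) ^ 2) by (intros; apply pow2_ge_0).
    assert (Hle : forall n, sum_n (fun n => Cmod (c n) ^ 2) n <= r ^ 2).
    { apply is_lim_seq_incr_compare; auto.
      intros n. rewrite sum_Sn. unfold plus; simpl. specialize (Hp (S n)). simpl in Hp. lra. }
    intros n. apply Rsqr_incr_0; auto; [|apply Cmod_ge_0]. rewrite !Rsqr_pow2.
    eapply Rle_trans; [|apply (Hle n)].
    destruct n as [|n]; [rewrite sum_O; lra|]. rewrite sum_Sn. unfold plus; simpl.
    assert (Q : 0 <= sum_n (fun n => Cmod (c n) ^ 2) n).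
    { clear -Hp. induction n as [|n IH]; [rewrite sum_O; auto|]. rewrite sum_Sn.
      unfold plus; simpl.
      specialize (Hp (S n)). simpl in *. lra. }
    simpl in *. lra. }
  assert (Hpart : forall n,
    Cmod (Csum (fun k => z ^ k * c k)%C n) <= r / (1 - Cmod z) * (1 - Cmod z ^ S n)).
  { induction n as [|n IH].
    - rewrite Csum_O. simpl. rewrite Cmult_1_l.
      replace (r / (1 - Cmod z) * (1 - Cmod z * 1)) with r by (field; lra). auto.
    - rewrite Csum_S. eapply Rle_trans; [apply Cmod_triangle|]. rewrite Cmod_mult Cmod_pow.
      assert (B : Cmod z ^ S n * Cmod (c (S n)) <= Cmod z ^ S n * r).
      { apply Rmult_le_compat_l; auto. apply pow_le; lra. }
      eapply Rle_trans; [apply Rplus_le_compat; [apply IH|apply B]|].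
      right. simpl. field. lra. }
  apply le_epsilon. intros eps He.
  destruct (pseries_limit _ _ _ (Ht z) eps He) as [N HN]. specialize (HN N (le_n _)).
  specialize (Hpart N).
  assert (A := Cmod_minus_ge (f z) (Csum (fun k => z ^ k * c k)%C N)).
  rewrite Cmod_minus_sym in A.
  assert (P0 : 0 <= r / (1 - Cmod z)) by (apply Rdiv_le_0_compat; lra).
  assert (P : 0 <= Cmod z ^ S N) by (apply pow_le; lra).
  nra.
Qed.

(** * The eigenfunctions of the composition operator *)

Definition eigenfunction (m : nat) : dfun := fun z => ((1 - z) ^ m)%C.

Lemma Cmod_one_minus z : Cmod (1 - z) <= 1 + Cmod z.
Proof. assert (A := Cmod_minus_le 1 z). now rewrite Cmod_1 in A. Qed.

Lemma cdiff_eigenfunction c m z : cdiff (fun z => c * (1 - z) ^ m)%C z.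
Proof.
  apply (cdiff_ext_loc (fun z => c * (1 + (RtoC (-1)) * z) ^ m)%C _ _ 1); [lra| |].
  - intros y _. f_equal. f_equal. apply C_ext; simpl; ring.
  - apply cdiff_scal. apply (cdiff_affine_comp (fun z => z ^ m)%C). apply cdiff_pow.
Qed.

Lemma H2_eigenfunction c m : H2 (dscal c (eigenfunction m)).
Proof.
  split.
  - exists (fun z => c * (1 - z) ^ m)%C. split; [reflexivity|].
    intros z. apply complex_differentiable_at_iff, cdiff_eigenfunction.
  - destruct (H2norm_le_of_bounded (fun z => c * (1 - z) ^ m)%C (Cmod c * 3 ^ m)) as [r [Hr _]].
    + intros z _. apply cdiff_eigenfunction.
    + intros z Hz. rewrite Cmod_mult Cmod_pow. apply Rmult_le_compat_l; [apply Cmod_ge_0|].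
      apply pow_incr. split; [apply Cmod_ge_0|]. assert (A := Cmod_one_minus z). lra.
    + exists r. exact Hr.
Qed.

Definition disk0 : disk := exist _ (RtoC 0) (eq_ind_r (fun x => x < 1) Rlt_0_1 Cmod_0).

Lemma eigenfunction_disk0 m : eigenfunction m disk0 = RtoC 1.
Proof. unfold eigenfunction. simpl. replace (1 - 0)%C with (RtoC 1) by ring.
  apply Cpow_1_l.
Qed.

(** Closedness: a limit of multiples [c (1 - z) ^ m] is a pointwise limit by
    [H2norm_eval], and the scalars are recovered as the values at 0, where
    the eigenfunction is 1. *)
Lemma closed_invariant_eigenline a Ha m (N : dfun -> Prop) :
  (forall f, N f <-> exists c, f = dscal c (eigenfunction m)) -> closed_invariant a Ha N.
Proof.
  intros HN. split; [split; [|split; [|split; [|split]]]|].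
  - intros f Hf. apply HN in Hf. destruct Hf as [c ->]. apply H2_eigenfunction.
  - apply HN. exists (RtoC 0). extensionality z. unfold dscal, dzero. ring.
  - intros f h Hf Hh. apply HN in Hf, Hh. destruct Hf as [c ->]. destruct Hh as [d ->].
    apply HN. exists (c + d)%C. extensionality z. unfold dscal, dadd. ring.
  - intros c f Hf. apply HN in Hf. destruct Hf as [d ->].
    apply HN. exists (c * d)%C. extensionality z. unfold dscal. ring.
  - intros f [_ Hf]. apply HN. exists (f disk0). extensionality z. unfold dscal.
    assert (E : (f z - f disk0 * eigenfunction m z)%C = RtoC 0).
    { apply Cmod_eq_0. apply Rle_antisym; [|apply Cmod_ge_0]. apply le_epsilon. intros eps He.
      rewrite Rplus_0_l.
      assert (Hz : 0 <= Cmod z < 1) by (split; [apply Cmod_ge_0|apply (proj2_sig z)]).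
      assert (Hi : 0 < / (1 - Cmod z)) by (apply Rinv_0_lt_compat; lra).
      assert (Hv := Cmod_ge_0 (eigenfunction m z)).
      destruct (Hf (eps / (/ (1 - Cmod z) + Cmod (eigenfunction m z))))
        as [h [Hh [r [Hr Hlt]]]].
      { apply Rdiv_lt_0_compat; lra. }
      apply HN in Hh. destruct Hh as [c ->].
      assert (A := H2norm_eval _ _ z Hr). assert (B := H2norm_eval _ _ disk0 Hr).
      unfold dsub, dscal in A, B. rewrite eigenfunction_disk0 in B. simpl in B.
      rewrite Cmod_0 Rminus_0_r Rdiv_1_r in B.
      replace (f z - f disk0 * eigenfunction m z)%C
        with ((f z - c * eigenfunction m z) - (f disk0 - c * 1) * eigenfunction m z)%C by ring.
      eapply Rle_trans; [apply Cmod_minus_le|]. rewrite Cmod_mult.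
      apply Rle_trans with (r * (/ (1 - Cmod z) + Cmod (eigenfunction m z))).
      - rewrite Rmult_plus_distr_l. apply Rplus_le_compat; auto. apply Rmult_le_compat_r; auto.
      - apply Rle_trans with (eps / (/ (1 - Cmod z) + Cmod (eigenfunction m z))
          * (/ (1 - Cmod z) + Cmod (eigenfunction m z))).
        + apply Rmult_le_compat_r; lra.
        + right. unfold Rdiv. rewrite Rmult_assoc Rinv_l; lra. }
    rewrite -(Cplus_0_l (f disk0 * eigenfunction m z)) -E. ring.
  - intros f Hf. apply HN in Hf. destruct Hf as [c ->]. apply HN.
    exists (c * RtoC a ^ m)%C. extensionality z. unfold comp_op, dscal, eigenfunction. simpl.
    replace (1 - (a * z + RtoC (1 - a)))%C with (RtoC a * (1 - z))%C
      by (rewrite RtoC_minus; ring).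
    rewrite Cpow_mult_l. ring.
Qed.

(** * The cyclic subspace of a function analytic at 1 *)

Lemma iter_comp_op a Ha n : forall g z, exists y : disk,
  Nat.iter n (comp_op a Ha) g z = g y /\ (1 - y)%C = (RtoC (a ^ n) * (1 - z))%C.
Proof.
  induction n as [|n IH]; intros g z.
  - exists z. split; auto. simpl. ring.
  - destruct (IH g (phi a Ha z)) as [y [H1 H2]]. exists y. split; [exact H1|].
    rewrite H2. simpl. rewrite RtoC_minus RtoC_mult. ring.
Qed.

Lemma lincomb_zero d c e : (forall i, (i < d)%nat -> c i = RtoC 0) -> lincomb d c e = dzero.
Proof.
  induction d as [|d IH]; intros H; [reflexivity|]. simpl. rewrite IH; [|auto]. rewrite H; auto.
  extensionality z. unfold dadd, dscal, dzero. ring.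
Qed.

Lemma orbit_span_single a Ha g x n : orbit_span a Ha g (dscal x (Nat.iter n (comp_op a Ha) g)).
Proof.
  exists (S n), (fun k => if Nat.eqb k n then x else RtoC 0). simpl.
  rewrite lincomb_zero.
  - rewrite Nat.eqb_refl. extensionality z. unfold dadd, dzero. ring.
  - intros i Hi. destruct (Nat.eqb_spec i n); auto. lia.
Qed.

(** The approximants are multiples of the iterates of [g], normalized so that
    their leading term at 1 is [c u ^ m]. *)
Lemma eigenfunction_in_K a Ha g F rho m b M c :
  0 < rho -> cdiff_disc F rho -> b <> RtoC 0 -> 0 <= M ->
  (forall z : disk, Cmod (1 - z) < rho -> g z = F (1 - z)%C) ->
  (forall u, Cmod u <= rho / 4 -> Cmod (F u - b * u ^ m) <= M * Cmod u ^ S m) ->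
  K a Ha g (dscal c (eigenfunction m)).
Proof.
  intros Hrho HF Hb HM Hg Hlead. split; [apply H2_eigenfunction|]. intros eps He.
  assert (Hbp : 0 < Cmod b) by now apply Cmod_gt_0.
  set (B := Cmod c / Cmod b * M * 3 ^ S m).
  assert (HB : 0 <= B).
  { unfold B. assert (0 <= Cmod c / Cmod b) by (apply Rdiv_le_0_compat; auto; apply Cmod_ge_0).
    assert (0 <= 3 ^ S m) by (apply pow_le; lra). apply Rmult_le_pos; auto.
    now apply Rmult_le_pos. }
  (* The first threshold makes the error small; the second one gives
     |q (1 - z)| <= rho / 4 for |z| <= 2, where the leading term is known, and
     keeps q (1 - z) in the domain of F for |z| < 3. *)
  destruct (geometric_small (4 * B) a 1 eps) as [N1 HN1]; try lra.
  destruct (geometric_small 12 a 1 rho) as [N2 HN2]; try lra.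
  set (n := (N1 + N2)%nat). specialize (HN1 n ltac:(lia)). specialize (HN2 n ltac:(lia)).
  rewrite Rdiv_1_r in HN1, HN2.
  set (q := a ^ n) in *. assert (Hq : 0 < q) by (apply pow_lt; lra).
  assert (Hqm : (RtoC q ^ m)%C <> RtoC 0).
  { apply Cpow_nz. intros E. apply RtoC_inj in E. lra. }
  set (x := (c / (b * RtoC q ^ m))%C).
  exists (dscal x (Nat.iter n (comp_op a Ha) g)). split; [apply orbit_span_single|].
  (* The error c (1 - z)^m - x F(q (1 - z)), extended beyond the unit disk to
     radius 3. *)
  set (E := fun z : C => (c * (1 - z) ^ m - x * F (RtoC q + RtoC (- q) * z))%C).
  assert (Eu : forall z : C, (RtoC q + RtoC (- q) * z)%C = (RtoC q * (1 - z))%C)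
    by (intros; rewrite RtoC_opp; ring).
  assert (Cu : forall z, Cmod (RtoC q * (1 - z)) <= q * (1 + Cmod z)).
  { intros z. rewrite Cmod_mult Cmod_R Rabs_pos_eq; [|lra].
    apply Rmult_le_compat_l; [lra|apply Cmod_one_minus]. }
  assert (HE : cdiff_disc E 3).
  { intros z Hz. apply cdiff_minus; [apply cdiff_eigenfunction|]. apply cdiff_scal.
    apply (cdiff_affine_comp F).
    apply HF. rewrite Eu. eapply Rle_lt_trans; [apply Cu|]. nra. }
  destruct (H2norm_le_of_bounded E (B * q) HE) as [r [Hr Hle]].
  { intros z Hz. unfold E. rewrite Eu. set (u := (RtoC q * (1 - z))%C).
    assert (Hu : Cmod u <= 3 * q) by (eapply Rle_trans; [apply Cu|nra]).
    replace (c * (1 - z) ^ m - x * F u)%C with (- (x * (F u - b * u ^ m)))%C.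
    2: { unfold x, u. rewrite Cpow_mult_l. field. split; auto. }
    rewrite Cmod_opp Cmod_mult. specialize (Hlead u ltac:(lra)).
    assert (Ex : Cmod x = Cmod c / (Cmod b * q ^ m)).
    { unfold x. rewrite Cmod_div; [|now apply Cmult_neq_0].
      rewrite Cmod_mult Cmod_pow Cmod_R Rabs_pos_eq; lra. }
    assert (Hqp : 0 < q ^ m) by (apply pow_lt; auto).
    apply Rle_trans with (Cmod c / (Cmod b * q ^ m) * (M * (3 * q) ^ S m)).
    - rewrite Ex. apply Rmult_le_compat_l.
      + apply Rdiv_le_0_compat; [apply Cmod_ge_0|]. now apply Rmult_lt_0_compat.
      + eapply Rle_trans; [apply Hlead|]. apply Rmult_le_compat_l; auto.
        apply pow_incr. split; [apply Cmod_ge_0|auto].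
    - right. unfold B. rewrite Rpow_mult_distr. simpl (q ^ S m). field. split; lra. }
  exists r. split; [|lra].
  replace (dsub (dscal c (eigenfunction m)) (dscal x (Nat.iter n (comp_op a Ha) g)))
    with (fun z : disk => E z); auto.
  extensionality z. unfold dsub, dscal, E, eigenfunction. f_equal. f_equal. f_equal.
  destruct (iter_comp_op a Ha n g z) as [y [H1 H2]]. rewrite H1 Eu. fold q in H2. rewrite -H2.
  symmetry. apply Hg.
  rewrite H2. eapply Rle_lt_trans; [apply Cu|]. assert (Hz := proj2_sig z). simpl in Hz.
  change (Cmod z < 1) in Hz. nra.
Qed.

Lemma analytic_at_1_disc g : analytic_at_1 g -> exists F rho, 0 < rho /\ cdiff_disc F rho /\
  forall z : disk, Cmod (1 - z) < rho -> g z = F (1 - z)%C.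
Proof.
  intros (U & F & HU & HU1 & HFg & HFd).
  destruct (HU _ HU1) as [rho Hrho].
  assert (Hin : forall y, Cmod (1 - y) < rho -> U y).
  { intros y Hy. rewrite Cmod_minus_sym in Hy. apply Hrho. split.
    - eapply Rle_lt_trans; [apply (fst_le_Cmod (y - 1)%C)|exact Hy].
    - eapply Rle_lt_trans; [apply (snd_le_Cmod (y - 1)%C)|exact Hy]. }
  exists (fun u => F (1 + RtoC (-1) * u)%C), rho. split; [apply cond_pos|]. split.
  - intros u Hu. apply (cdiff_affine_comp F). apply complex_differentiable_at_iff, HFd, Hin.
    replace (1 - (1 + RtoC (-1) * u))%C with u by (apply C_ext; simpl; ring). exact Hu.
  - intros z Hz. rewrite -HFg; auto. f_equal. apply C_ext; simpl; ring.
Qed.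

Lemma exists_eigenfunction_in_K a Ha g : H2 g -> analytic_at_1 g -> g <> dzero ->
  exists m, forall c, K a Ha g (dscal c (eigenfunction m)).
Proof.
  intros [[Gt [HG1 HG2]] _] Han Hne.
  destruct (analytic_at_1_disc g Han) as (F & rho & Hrho & HF & Hg).
  destruct (leading_term F (rho / 2) rho HF) as [Z|(m & b & M & Hb & HM & H)]; [lra| |].
  - exfalso. apply Hne. extensionality z. rewrite -HG1.
    apply (vanish_near_one Gt (rho / 2)); [|lra| |apply (proj2_sig z)].
    + intros w Hw. apply complex_differentiable_at_iff. exact (HG2 (exist _ w Hw)).
    + intros w Hw Hwd. rewrite (HG1 (exist _ w Hw)) Hg; simpl; [now apply Z|lra].
  - exists m. intros c. apply (eigenfunction_in_K a Ha g F rho m b M); auto.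
    intros u Hu. apply H. lra.
Qed.

Lemma K_zero a Ha f : K a Ha dzero f -> f = dzero.
Proof.
  intros [_ Hf]. extensionality z. apply Cmod_eq_0. apply Rle_antisym; [|apply Cmod_ge_0].
  apply le_epsilon. intros eps He. rewrite Rplus_0_l.
  assert (Hz : 0 <= Cmod z < 1) by (split; [apply Cmod_ge_0|apply (proj2_sig z)]).
  destruct (Hf (eps * (1 - Cmod z))) as (h & (d & c & ->) & r & Hr & Hlt).
  { apply Rmult_lt_0_compat; lra. }
  assert (E : lincomb d c (fun n => Nat.iter n (comp_op a Ha) dzero) = dzero).
  { assert (I : forall n, Nat.iter n (comp_op a Ha) dzero = dzero).
    { induction n as [|n IH]; [reflexivity|]. simpl. rewrite IH. reflexivity. }
    clear Hr. induction d as [|d IH]; [reflexivity|]. simpl. rewrite IH I.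
    extensionality y. unfold dadd, dscal, dzero. ring. }
  rewrite E in Hr. assert (A := H2norm_eval _ _ z Hr). unfold dsub, dzero in A.
  replace (f z - 0)%C with (f z) in A by ring.
  eapply Rle_trans; [apply A|]. apply Rmult_le_reg_r with (1 - Cmod z); [lra|].
  unfold Rdiv. rewrite Rmult_assoc Rinv_l; lra.
Qed.

Lemma lincomb_1 c e : lincomb 1 c e = dscal (c O) (e O).
Proof. extensionality z. simpl. unfold dadd, dscal, dzero. ring. Qed.

(** * Minimality *)

Theorem theorem16 (a : R) (Ha : 0 < a < 1) (g : dfun)
  (Hg : H2 g) (Hg1 : analytic_at_1 g) :
  minimal_invariant a Ha (K a Ha g) <-> has_dim (K a Ha g) 1.
Proof.
  assert (Hone : RtoC 1 <> RtoC 0) by (intros E; apply RtoC_inj in E; lra).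
  destruct (classic (g = dzero)) as [->|Hne].
  { split.
    - intros (_ & (f & Hf & Hf0) & _). exfalso. apply Hf0. eapply K_zero; eauto.
    - intros (e & He & Hfree & _). exfalso. apply Hone.
      apply (Hfree (fun _ => RtoC 1)) with O; auto.
      rewrite lincomb_1 (K_zero a Ha (e O)); auto. extensionality z. unfold dscal, dzero. ring. }
  destruct (exists_eigenfunction_in_K a Ha g Hg Hg1 Hne) as [m Hm].
  assert (Hv : forall c, dscal c (eigenfunction m) = dzero -> c = RtoC 0).
  { intros c E. assert (E0 := f_equal (fun f => f disk0) E). unfold dscal, dzero in E0.
    rewrite eigenfunction_disk0 in E0. rewrite -E0. ring. }
  split.
  - intros (_ & _ & Hmin).
    destruct (Hmin (fun f => exists c, f = dscal c (eigenfunction m))) as [Z|HK].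
    + apply (closed_invariant_eigenline a Ha m). tauto.
    + intros f [c ->]. apply Hm.
    + exfalso. apply Hone, Hv, Z. eexists; reflexivity.
    + exists (fun _ => dscal 1 (eigenfunction m)). split; [intros; apply Hm|]. split.
      * intros c E i Hi. replace i with O by lia. rewrite lincomb_1 in E. apply Hv. rewrite -E.
        extensionality z. unfold dscal. ring.
      * intros f Hf. destruct (HK f Hf) as [c ->]. exists (fun _ => c). rewrite lincomb_1.
        extensionality z. unfold dscal. ring.
  - intros (e & _ & _ & Hspan).
    destruct (Hspan _ (Hm (RtoC 1))) as [c1 E1]. rewrite lincomb_1 in E1.
    assert (Hc1 : c1 O <> RtoC 0).
    { intros E. apply Hone, Hv. rewrite E1 E. extensionality z. unfold dscal, dzero. ring. }
    assert (HK : forall f, K a Ha g f <-> exists c, f = dscal c (eigenfunction m)).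
    { intros f. split.
      - intros Hf. destruct (Hspan f Hf) as [c Ef]. rewrite lincomb_1 in Ef.
        exists (c O / c1 O)%C. rewrite Ef. extensionality z.
        assert (E2 := f_equal (fun h => h z) E1). unfold dscal in E2 |- *.
        replace (eigenfunction m z) with (1 * eigenfunction m z)%C by ring. rewrite E2.
        field; auto.
      - intros [c ->]. apply Hm. }
    split; [now apply (closed_invariant_eigenline a Ha m)|]. split.
    + exists (dscal 1 (eigenfunction m)). split; [apply Hm|]. intros E. now apply Hone, Hv.
    + intros N [(_ & _ & _ & Hscal & _) _] HNK.
      destruct (classic (forall f, N f -> f = dzero)) as [Z|NZ]; [now left|right].
      apply not_all_ex_not in NZ. destruct NZ as [f0 Hf0]. apply imply_to_and in Hf0.
      destruct Hf0 as [Hf0 Hf0n]. destruct (proj1 (HK f0) (HNK f0 Hf0)) as [c0 E0].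
      assert (Hc0 : c0 <> RtoC 0).
      { intros E. apply Hf0n. rewrite E0 E. extensionality z. unfold dscal, dzero. ring. }
      intros f Hf. destruct (proj1 (HK f) Hf) as [c ->].
      replace (dscal c (eigenfunction m)) with (dscal (c / c0)%C f0); [now apply Hscal|].
      rewrite E0. extensionality z. unfold dscal. field; auto.
Qed.
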